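(* Assume the Minimum-Weight 4-Clique hypothesis. Then any algorithm solving incremental $(s,t)$-shortest path ({\rm stSP}), and likewise any algorithm solving decremental {\rm stSP}, on $n$-node undirected graphs with nonnegative integer edge weights requires $n^{4-o(1)}$ total time.
   Context: In {\rm stSP} one is given a weighted graph with two fixed nodes $s,t$ and must maintain (report after every update) the shortest-path distance from $s$ to $t$. In the incremental setting the graph starts empty and undergoes only edge insertions; in the decremental setting it undergoes only edge deletions (until empty). Total time means the total time of preprocessing, all updates and all queries. Minimum-Weight $k$-Clique hypothesis: for no $\varepsilon>0$ is there an $O(n^{k-\varepsilon})$-time algorithm that, given an $n$-node graph with nonnegative integer edge weights, finds a $k$-clique of minimum total edge weight; here $k=4$. *)

(* Defs.v *)
From Stdlib Require Import Reals Arith List.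
Import ListNotations.

(** * Word RAM

    Programs are structured three-address programs for a word RAM with [W]-bit
    words: finitely many registers and finitely many arrays occur in a program,
    every elementary instruction and every test costs one unit of time, and all
    arithmetic is modulo [2 ^ W]. *)

Inductive binop : Set :=
| Add | Sub | Mul | Div | Mod | And | Or | Xor | Shl | Shr | Eq | Lt.

Definition eval_binop (W : nat) (o : binop) (a b : nat) : nat :=
  (match o with
   | Add => a + b
   | Sub => a + (2 ^ W - b)
   | Mul => a * b
   | Div => a / b
   | Mod => a mod b
   | And => Nat.land a b
   | Or  => Nat.lor a b
   | Xor => Nat.lxor a b
   | Shl => Nat.shiftl a b
   | Shr => Nat.shiftr a b
   | Eq  => if a =? b then 1 else 0
   | Lt  => if a <? b then 1 else 0
   end) mod 2 ^ W.

Inductive com : Set :=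
| Skip
| Const (x k : nat)                 (* x := k *)
| Op (x : nat) (o : binop) (y z : nat)  (* x := y o z *)
| Read (x a i : nat)                (* x := a[i], [i] a register *)
| Write (a i x : nat)               (* a[i] := x, [i] a register *)
| Seq (c1 c2 : com)
| If (x : nat) (c1 c2 : com)        (* a nonzero word is true *)
| While (x : nat) (c : com).

(** [mem st a i] is the word in cell [i] of array [a]. *)
Record state : Type := State { reg : nat -> nat; mem : nat -> nat -> nat }.

Definition set_reg (st : state) (x v : nat) : state :=
  State (fun y => if y =? x then v else reg st y) (mem st).

Definition set_mem (st : state) (a i v : nat) : state :=
  State (reg st)
        (fun b j => if (b =? a) && (j =? i) then v else mem st b j)%bool.

(** [exec W c st t st']: started in [st], the program [c] halts in [st'] after
    exactly [t] steps. *)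
Inductive exec (W : nat) : com -> state -> nat -> state -> Prop :=
| exec_skip st : exec W Skip st 1 st
| exec_const st x k :
    exec W (Const x k) st 1 (set_reg st x (k mod 2 ^ W))
| exec_op st x o y z :
    exec W (Op x o y z) st 1
         (set_reg st x (eval_binop W o (reg st y) (reg st z)))
| exec_read st x a i :
    exec W (Read x a i) st 1 (set_reg st x (mem st a (reg st i)))
| exec_write st a i x :
    exec W (Write a i x) st 1 (set_mem st a (reg st i) (reg st x))
| exec_seq c1 c2 st t1 st1 t2 st2 :
    exec W c1 st t1 st1 -> exec W c2 st1 t2 st2 ->
    exec W (Seq c1 c2) st (t1 + t2) st2
| exec_if_true x c1 c2 st t st' :
    reg st x <> 0 -> exec W c1 st t st' -> exec W (If x c1 c2) st (S t) st'
| exec_if_false x c1 c2 st t st' :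
    reg st x = 0 -> exec W c2 st t st' -> exec W (If x c1 c2) st (S t) st'
| exec_while_false x c st :
    reg st x = 0 -> exec W (While x c) st 1 st
| exec_while_true x c st t1 st1 t2 st2 :
    reg st x <> 0 -> exec W c st t1 st1 -> exec W (While x c) st1 t2 st2 ->
    exec W (While x c) st (S (t1 + t2)) st2.

(** Words have [O(log n + log U)] bits for inputs with [n] nodes and weights at
    most [U]: the word size may be any [W] with [W >= c * log2 (n + U + 2)],
    where the constant [c] is chosen by the algorithm. *)
Definition word_size_ok (c n U W : nat) : Prop := (n + U + 2) ^ c <= 2 ^ W.

Definition is_bigO (T : nat -> nat) (f : nat -> R) : Prop :=
  exists (C : R) (n0 : nat),
    forall n, n0 <= n -> (INR (T n) <= C * f n)%R.

(** * Weighted graphs *)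

(** Edge weights; [None] stands for the absence of an edge. *)
Definition wgraph : Type := nat -> nat -> option nat.

Definition is_graph (n : nat) (g : wgraph) : Prop :=
  (forall u v w, g u v = Some w -> u < n /\ v < n)
  /\ (forall u v, g u v = g v u)
  /\ (forall u, g u u = None).

Definition weights_le (g : wgraph) (U : nat) : Prop :=
  forall u v w, g u v = Some w -> w <= U.

Definition empty_graph : wgraph := fun _ _ => None.

Definition set_edge (g : wgraph) (u v : nat) (o : option nat) : wgraph :=
  fun x y =>
    if ((x =? u) && (y =? v) || (x =? v) && (y =? u))%bool then o else g x y.

Inductive walk (g : wgraph) : nat -> nat -> nat -> Prop :=
| walk_nil x : walk g x x 0
| walk_cons x y z w l :
    g x y = Some w -> walk g y z l -> walk g x z (w + l).

Definition is_dist (g : wgraph) (s t d : nat) : Prop :=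
  walk g s t d /\ (forall l, walk g s t l -> d <= l).

(** A state whose registers [0, 1, ...] hold the words of [l] and whose other
    registers are as in [st]. *)
Definition load_regs (st : state) (l : list nat) : state :=
  State (fun x => nth x l (reg st x)) (mem st).

Definition zero_state : state := State (fun _ => 0) (fun _ _ => 0).

(** The adjacency matrix of [g] in array [0] and the weight matrix in array [1],
    both row by row: cell [u * n + v] describes the pair [(u, v)]. *)
Definition graph_state (n : nat) (g : wgraph) : state :=
  State (fun _ => 0)
        (fun a i =>
           match a, g (i / n) (i mod n) with
           | 0, Some _ => 1
           | 1, Some w => w
           | _, _ => 0
           end).

(** * Minimum-weight k-clique *)

Definition is_clique (g : wgraph) (k : nat) (l : list nat) : Prop :=
  length l = k /\ NoDup l
  /\ (forall u v, In u l -> In v l -> u <> v -> g u v <> None).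

Definition weight (g : wgraph) (u v : nat) : nat :=
  match g u v with Some w => w | None => 0 end.

Fixpoint clique_weight (g : wgraph) (l : list nat) : nat :=
  match l with
  | [] => 0
  | u :: l' => list_sum (map (weight g u) l') + clique_weight g l'
  end.

Definition is_min_clique (n : nat) (g : wgraph) (k : nat) (l : list nat) : Prop :=
  is_clique g k l /\ Forall (fun u => u < n) l
  /\ (forall l', is_clique g k l' -> Forall (fun u => u < n) l' ->
        clique_weight g l <= clique_weight g l').

(** Output: register [0] tells whether there is a [k]-clique; if so, registers
    [1, ..., k] hold the vertices of one of minimum weight. *)
Definition clique_output (n : nat) (g : wgraph) (k : nat) (st : state) : Prop :=
  (reg st 0 = 1 /\ is_min_clique n g k (map (reg st) (seq 1 k)))
  \/ (reg st 0 = 0 /\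
      ~ exists l, is_clique g k l /\ Forall (fun u => u < n) l).

Definition solves_min_clique (k : nat) (P : com) (T : nat -> nat) : Prop :=
  exists c, forall n g U W,
    is_graph n g -> weights_le g U -> word_size_ok c n U W ->
    exists t st,
      exec W P (load_regs (graph_state n g) [n]) t st
      /\ t <= T n
      /\ clique_output n g k st.

Definition min_weight_clique_hypothesis (k : nat) : Prop :=
  forall eps : R, (0 < eps)%R ->
    ~ exists (P : com) (T : nat -> nat),
        solves_min_clique k P T
        /\ is_bigO T (fun n => Rpower (INR n) (INR k - eps)).

(** * Partially dynamic st-shortest path *)

Inductive update : Set :=
| Insert (u v w : nat)
| Delete (u v : nat).

Definition is_insert (o : update) : Prop :=
  match o with Insert _ _ _ => True | Delete _ _ => False end.

Definition is_delete (o : update) : Prop :=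
  match o with Insert _ _ _ => False | Delete _ _ => True end.

Definition apply_update (g : wgraph) (o : update) : wgraph :=
  match o with
  | Insert u v w => set_edge g u v (Some w)
  | Delete u v => set_edge g u v None
  end.

(** Graphs stay simple: only absent edges are inserted, only present edges are
    deleted. *)
Definition legal (n : nat) (g : wgraph) (o : update) : Prop :=
  match o with
  | Insert u v _ => u < n /\ v < n /\ u <> v /\ g u v = None
  | Delete u v => g u v <> None
  end.

Fixpoint legal_seq (n : nat) (g : wgraph) (os : list update) : Prop :=
  match os with
  | [] => True
  | o :: os' => legal n g o /\ legal_seq n (apply_update g o) os'
  end.

Definition update_words (o : update) : list nat :=
  match o with Insert u v w => [u; v; w] | Delete u v => [u; v] end.

(** A dynamic algorithm: a program for the preprocessing and a program that is
    run once per update on the memory left by the previous runs. *)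
Record dyn_alg : Set := DynAlg { preprocess : com; process : com }.

(** Report: register [0] tells whether [t] is reachable from [s]; if so,
    register [1] holds the distance. *)
Definition reports (g : wgraph) (s t : nat) (st : state) : Prop :=
  (reg st 0 = 1 /\ is_dist g s t (reg st 1))
  \/ (reg st 0 = 0 /\ ~ exists l, walk g s t l).

(** [serves W P s t g st os time]: from the memory [st] and the current graph
    [g], the updates [os] are revealed one at a time; [P] answers each of them
    correctly before the next one arrives, in [time] steps altogether. *)
Inductive serves (W : nat) (P : com) (s t : nat) :
  wgraph -> state -> list update -> nat -> Prop :=
| serves_nil g st : serves W P s t g st [] 0
| serves_cons g st o os t1 st1 t2 :
    exec W P (load_regs st (update_words o)) t1 st1 ->
    reports (apply_update g o) s t st1 ->
    serves W P s t (apply_update g o) st1 os t2 ->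
    serves W P s t g st (o :: os) (t1 + t2).

Definition solves_incremental_stSP (A : dyn_alg) (T : nat -> nat) : Prop :=
  exists c, forall n s t os U W,
    s < n -> t < n -> s <> t ->
    Forall is_insert os ->
    legal_seq n empty_graph os ->
    weights_le (fold_left apply_update os empty_graph) U ->
    word_size_ok c n U W ->
    exists t0 st0 t1,
      exec W (preprocess A) (load_regs zero_state [n; s; t]) t0 st0
      /\ serves W (process A) s t empty_graph st0 os t1
      /\ t0 + t1 <= T n.

Definition solves_decremental_stSP (A : dyn_alg) (T : nat -> nat) : Prop :=
  exists c, forall n s t g os U W,
    s < n -> t < n -> s <> t ->
    is_graph n g -> weights_le g U ->
    Forall is_delete os ->
    legal_seq n g os ->
    (forall u v, fold_left apply_update os g u v = None) ->
    word_size_ok c n U W ->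
    exists t0 st0 t1,
      exec W (preprocess A) (load_regs (graph_state n g) [n; s; t]) t0 st0
      /\ serves W (process A) s t g st0 os t1
      /\ t0 + t1 <= T n.

(* Main.v *)
(** A 4-clique [{a, b, c, d}] is read off a path
    [s - h - b - c - x - c - d - y - d - b - h - t] in a layered graph: the edges
    [bc], [cd], [db] are edges of the path, and the weights of [ac] and [ad] are
    collected while passing from one copy of [c] (of [d]) to the next.  This takes
    [n] different weights for each such passage, one for every [a], but only [O(n)]
    nodes: in phase [a] the passage at [c] leads through the node
    [x = (c + a) mod n] shared by all [c].  Every edge at [x] is then inserted
    exactly once, and as later phases get weights smaller by a large [L], a cheapest
    path uses at [x] only the two edges of the current phase, hence does not switch
    from [c] to another [c'].  Likewise one new edge at each end of the path, through
    the hub [h = a], selects [b].  The distances after the [n ^ 2] phases [(a, b)]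
    thus give the minimum over all 4-cliques from [O(n ^ 2)] insertions into a graph
    with [12 n] nodes.  The same sequence of graphs run backwards serves for
    deletions; the graph of the last phase [(n - 1, n - 1)] is not reported then, but
    it is not needed since [a <> b]. *)

From Stdlib Require Import Reals Arith List Lia Lra FunctionalExtensionality.
Require Import Defs.
Import ListNotations.

(** A dynamic algorithm is only available as a word-RAM program, so the reduction has to be a
    program as well: much of the work is to embed foreign code, to compile arithmetic without
    overflow and to account for the time. The constants come from three requirements. The sum of six
    pair weights must stay below [B] for a clique and reach it otherwise, so [B] is one more than
    six times a bound on all weights. A path collects five pair weights of at most [B] each, so a
    penalty [L = 5 * B + 1] outweighs any saving from an edge of an earlier phase. Finally, edges
    are undirected and a walk may turn back: every edge carries an extra [M = 7 * (n * n) * L],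
    larger than all penalties and pair weights on a good path together, so that a twelfth edge never
    pays. The sixth weight, that of [ab], is constant within a phase and is added to the distance
    afterwards. *)

Local Arguments Nat.ltb : simpl never.
Local Arguments Nat.leb : simpl never.

(** * Running a foreign program inside a larger one *)

(** Registers [0 .. 19] are variables of the reduction, registers [20 .. 39] are
    scratch, and register [x] and array [a] of the dynamic algorithm become
    register [40 + x] and array [10 + a]. *)
Fixpoint shift (c : com) : com :=
  match c with
  | Skip => Skip
  | Const x k => Const (40 + x) k
  | Op x o y z => Op (40 + x) o (40 + y) (40 + z)
  | Read x a i => Read (40 + x) (10 + a) (40 + i)
  | Write a i x => Write (10 + a) (40 + i) (40 + x)
  | Seq c1 c2 => Seq (shift c1) (shift c2)
  | If x c1 c2 => If (40 + x) (shift c1) (shift c2)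
  | While x c => While (40 + x) (shift c)
  end.

Definition simulates (st S : state) : Prop :=
  (forall x, reg S (40 + x) = reg st x) /\
  (forall a i, mem S (10 + a) i = mem st a i).

Definition same_low (S S' : state) : Prop :=
  (forall x, x < 40 -> reg S' x = reg S x) /\
  (forall a i, a < 10 -> mem S' a i = mem S a i).

Lemma same_low_trans S1 S2 S3 :
  same_low S1 S2 -> same_low S2 S3 -> same_low S1 S3.
Proof.
  intros [r1 m1] [r2 m2]; split; intros.
  - now rewrite r2, r1.
  - now rewrite m2, m1.
Qed.

Lemma simulates_set_reg st S x v :
  simulates st S ->
  simulates (set_reg st x v) (set_reg S (40 + x) v) /\
  same_low S (set_reg S (40 + x) v).
Proof.
  intros [hr hm]; repeat split; intros.
  - cbn; destruct (x0 =? x); [auto|apply hr].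
  - apply hm.
  - unfold set_reg; cbn [reg]. destruct (Nat.eqb_spec x0 (40 + x)); auto; lia.
Qed.

Lemma simulates_set_mem st S a i v :
  simulates st S ->
  simulates (set_mem st a i v) (set_mem S (10 + a) i v) /\
  same_low S (set_mem S (10 + a) i v).
Proof.
  intros [hr hm]; repeat split; intros.
  - apply hr.
  - cbn; destruct (a0 =? a), (i0 =? i); cbn; auto; apply hm.
  - unfold set_mem; cbn [mem].
    destruct (Nat.eqb_spec a0 (10 + a)); cbn [andb]; auto; lia.
Qed.

(** Renaming preserves the step count, so the running time of the dynamic algorithm enters the
    reduction unchanged; [same_low] records that the data of the reduction survive the call. *)
Lemma exec_shift W c st t st' :
  exec W c st t st' ->
  forall S, simulates st S ->
  exists S', exec W (shift c) S t S' /\ simulates st' S' /\ same_low S S'.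
Proof.
  induction 1 as [st|st x k|st x o y z|st x a i|st a i x
    |c1 c2 st t1 st1 t2 st2 _ IH1 _ IH2|x c1 c2 st t st' hx _ IH|x c1 c2 st t st' hx _ IH
    |x c st hx|x c st t1 st1 t2 st2 hx _ IH1 _ IH2]; intros S hS; cbn [shift];
    pose proof hS as [hr hm].
  - exists S; repeat split; auto; constructor.
  - eexists; split; [constructor|]. apply simulates_set_reg, hS.
  - eexists; split; [constructor|]. rewrite !hr. apply simulates_set_reg, hS.
  - eexists; split; [constructor|]. rewrite !hr, hm. apply simulates_set_reg, hS.
  - eexists; split; [constructor|]. rewrite !hr. apply simulates_set_mem, hS.
  - destruct (IH1 S hS) as (S1 & e1 & s1 & l1).
    destruct (IH2 S1 s1) as (S2 & e2 & s2 & l2).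
    exists S2; split; [econstructor; eauto|split; auto].
    eapply same_low_trans; eauto.
  - destruct (IH S hS) as (S1 & e1 & s1 & l1).
    exists S1; split; [apply exec_if_true; auto; now rewrite hr|auto].
  - destruct (IH S hS) as (S1 & e1 & s1 & l1).
    exists S1; split; [apply exec_if_false; auto; now rewrite hr|auto].
  - exists S; split; [apply exec_while_false; now rewrite hr|].
    split; auto. split; auto.
  - destruct (IH1 S hS) as (S1 & e1 & s1 & l1).
    destruct (IH2 S1 s1) as (S2 & e2 & s2 & l2).
    exists S2; split; [eapply exec_while_true; eauto; now rewrite hr|split; auto].
    eapply same_low_trans; eauto.
Qed.

(** * Straight-line code over natural-number expressions *)

Inductive expr : Set :=
| V (x : nat)
| C (k : nat)
| E (o : binop) (e1 e2 : expr)
| G (a : nat) (e : expr).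

Definition nat_binop (o : binop) (a b : nat) : nat :=
  match o with
  | Add => a + b
  | Sub => a - b
  | Mul => a * b
  | Div => a / b
  | Mod => a mod b
  | And => Nat.land a b
  | Or  => Nat.lor a b
  | Xor => Nat.lxor a b
  | Shl => Nat.shiftl a b
  | Shr => Nat.shiftr a b
  | Eq  => if a =? b then 1 else 0
  | Lt  => if a <? b then 1 else 0
  end.

Fixpoint ev (s : state) (e : expr) : nat :=
  match e with
  | V x => reg s x
  | C k => k
  | E o e1 e2 => nat_binop o (ev s e1) (ev s e2)
  | G a e => mem s a (ev s e)
  end.

(** Machine subtraction wraps around whereas subtraction on [nat] truncates at 0; the two agree when
    [b <= a]. Comparisons return a bit, which fits into any nonempty word. *)
Definition binop_ok (W : nat) (o : binop) (a b : nat) : Prop :=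
  match o with
  | Sub => b <= a /\ a < 2 ^ W
  | Eq | Lt => True
  | _ => nat_binop o a b < 2 ^ W
  end.

Fixpoint expr_ok (W : nat) (s : state) (e : expr) : Prop :=
  match e with
  | V x => True
  | C k => k < 2 ^ W
  | E o e1 e2 =>
      expr_ok W s e1 /\ expr_ok W s e2 /\ binop_ok W o (ev s e1) (ev s e2)
  | G a e => expr_ok W s e
  end.

Definition is_var (x : nat) : bool := ((x <? 20) || (40 <=? x))%bool.

(** All variables occurring in [e] are proper variables, and the scratch
    registers from [r] on suffice to evaluate it. *)
Fixpoint expr_wf (r : nat) (e : expr) : bool :=
  match e with
  | V x => is_var x
  | C k => r <? 40
  | E o e1 e2 => expr_wf r e1 && expr_wf (S r) e2 && (r <? 40)
  | G a e => expr_wf r e && (r <? 40)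
  end.

(** Code evaluating [e] with scratch registers from [r] on, and the register
    holding the result. *)
Fixpoint compile_expr (r : nat) (e : expr) : com * nat :=
  match e with
  | V x => (Skip, x)
  | C k => (Const r k, r)
  | E o e1 e2 =>
      let (c1, x1) := compile_expr r e1 in
      let (c2, x2) := compile_expr (S r) e2 in
      (Seq c1 (Seq c2 (Op r o x1 x2)), r)
  | G a e => let (c, x) := compile_expr r e in (Seq c (Read r a x), r)
  end.

Fixpoint expr_cost (e : expr) : nat :=
  match e with
  | V _ | C _ => 1
  | E _ e1 e2 => expr_cost e1 + (expr_cost e2 + 1)
  | G _ e => expr_cost e + 1
  end.

Definition agree_below (r : nat) (S S' : state) : Prop :=
  (forall x, x < r \/ 40 <= x -> reg S x = reg S' x) /\
  (forall a i, mem S a i = mem S' a i).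

Definition agree : state -> state -> Prop := agree_below 20.

Lemma agree_below_trans r S1 S2 S3 :
  agree_below r S1 S2 -> agree_below r S2 S3 -> agree_below r S1 S3.
Proof.
  intros [r1 m1] [r2 m2]; split; intros; [rewrite r1|rewrite m1]; auto.
Qed.

Lemma agree_below_weaken r r' S S' :
  r' <= r -> agree_below r S S' -> agree_below r' S S'.
Proof. intros h [hr hm]; split; auto; intros; apply hr; lia. Qed.

Lemma agree_below_sym r S S' : agree_below r S S' -> agree_below r S' S.
Proof. intros [hr hm]; split; intros; symmetry; auto. Qed.

Lemma agree_refl S : agree S S.
Proof. split; auto. Qed.

Lemma set_reg_agree r S x v : r <= x < 40 -> agree_below r (set_reg S x v) S.
Proof.
  intros h; split; auto; intros y hy. cbn.
  destruct (Nat.eqb_spec y x); auto; lia.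
Qed.

Lemma is_var_spec x : is_var x = true -> x < 20 \/ 40 <= x.
Proof.
  unfold is_var; rewrite Bool.orb_true_iff, Nat.ltb_lt, Nat.leb_le; tauto.
Qed.

(** This keeps the first operand alive while the second one is evaluated with the scratch registers
    from [S r] on. *)
Lemma compile_expr_reg r e c x :
  compile_expr r e = (c, x) -> expr_wf r e = true ->
  x < 20 \/ 40 <= x \/ x = r.
Proof.
  destruct e; cbn; intros H hw.
  - injection H as <- <-. apply is_var_spec in hw; tauto.
  - injection H as <- <-; auto.
  - destruct (compile_expr r e1), (compile_expr (S r) e2).
    injection H as <- <-; auto.
  - destruct (compile_expr r e); injection H as <- <-; auto.
Qed.

Lemma ev_agree s s' r r' e :
  agree_below r s s' -> 20 <= r -> expr_wf r' e = true -> ev s e = ev s' e.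
Proof.
  intros [hr hm] h; revert r'; induction e; intros r' hw; cbn in *; auto.
  - apply hr; apply is_var_spec in hw; lia.
  - rewrite !Bool.andb_true_iff in hw. erewrite IHe1, IHe2; eauto; apply hw.
  - rewrite !Bool.andb_true_iff in hw. erewrite IHe, hm; eauto; apply hw.
Qed.

Lemma expr_ok_agree W s s' r r' e :
  agree_below r s s' -> 20 <= r -> expr_wf r' e = true ->
  expr_ok W s e -> expr_ok W s' e.
Proof.
  intros hs h; revert r'; induction e; intros r' hw; cbn in *; auto.
  - rewrite !Bool.andb_true_iff in hw; destruct hw as [[h1 h2] _].
    rewrite (ev_agree _ _ _ _ _ hs h h1), (ev_agree _ _ _ _ _ hs h h2).
    intros (a & b & c); eauto.
  - rewrite !Bool.andb_true_iff in hw; destruct hw; eauto.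
Qed.

Lemma eval_binop_ok W o a b :
  0 < W -> binop_ok W o a b -> eval_binop W o a b = nat_binop o a b.
Proof.
  intros hW. assert (2 <= 2 ^ W).
  { change 2 with (2 ^ 1) at 1; apply Nat.pow_le_mono_r; lia. }
  unfold eval_binop; destruct o; cbn [nat_binop binop_ok]; intros h;
    try (apply Nat.mod_small; assumption).
  - destruct h as [h1 h2]. replace (a + (2 ^ W - b)) with (a - b + 1 * 2 ^ W) by lia.
    rewrite Nat.Div0.mod_add. apply Nat.mod_small; lia.
  - apply Nat.mod_small; destruct (a =? b); lia.
  - apply Nat.mod_small; destruct (a <? b); lia.
Qed.

Lemma compile_expr_correct W e r S :
  0 < W -> 20 <= r -> expr_wf r e = true -> expr_ok W S e ->
  exists t S',
    exec W (fst (compile_expr r e)) S t S' /\ t <= expr_cost e /\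
    agree_below r S' S /\ reg S' (snd (compile_expr r e)) = ev S e.
Proof.
  intros hW; revert r S; induction e as [x|k|o e1 IH1 e2 IH2|a e IH];
    intros r S hr hw ok; cbn in hw, ok |- *.
  - exists 1, S; repeat split; auto; constructor.
  - apply Nat.ltb_lt in hw.
    exists 1, (set_reg S r (k mod 2 ^ W)); split; [constructor|].
    split; auto. split; [now apply set_reg_agree|].
    cbn; rewrite Nat.eqb_refl. now apply Nat.mod_small.
  - rewrite !Bool.andb_true_iff in hw; destruct hw as [[h1 h2] h3].
    apply Nat.ltb_lt in h3. destruct ok as (o1 & o2 & o3).
    destruct (IH1 r S hr h1 o1) as (t1 & S1 & x1 & l1 & a1 & v1).
    pose proof (ev_agree _ _ _ _ _ a1 hr h2) as v2'.
    destruct (IH2 (Datatypes.S r) S1) as (t2 & S2 & x2 & l2 & a2 & v2); auto.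
    { eapply expr_ok_agree; [apply agree_below_sym, a1| | |]; eauto. }
    destruct (compile_expr r e1) as [c1 y1] eqn:E1.
    destruct (compile_expr (Datatypes.S r) e2) as [c2 y2] eqn:E2.
    cbn in *.
    assert (reg S2 y1 = reg S1 y1) as hy.
    { apply a2. pose proof (compile_expr_reg _ _ _ _ E1 h1). lia. }
    eexists (t1 + (t2 + 1)), _; split;
      [econstructor; [eassumption|econstructor; [eassumption|constructor]]|].
    split; [lia|]. split.
    + eapply agree_below_trans; [apply set_reg_agree; lia|].
      eapply agree_below_trans; [|exact a1].
      eapply agree_below_weaken; [|exact a2]; lia.
    + cbn; rewrite Nat.eqb_refl, hy, v1, v2, v2'. now apply eval_binop_ok.
  - rewrite !Bool.andb_true_iff in hw; destruct hw as [h1 h3].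
    apply Nat.ltb_lt in h3.
    destruct (IH r S hr h1 ok) as (t1 & S1 & x1 & l1 & a1 & v1).
    destruct (compile_expr r e) as [c1 y1] eqn:E1; cbn in *.
    exists (t1 + 1), (set_reg S1 r (mem S1 a (reg S1 y1))).
    split; [repeat (econstructor; eauto)|]. split; [lia|]. split.
    + eapply agree_below_trans; [apply set_reg_agree; lia|auto].
    + cbn; rewrite Nat.eqb_refl, v1. apply a1.
Qed.

(** * Assignments, conditionals and loops *)

Inductive stmt : Set :=
| Asg (x : nat) (e : expr)
| Put (a : nat) (i e : expr)
| Then (c1 c2 : stmt)
| Cond (e : expr) (c1 c2 : stmt)
| Nop.

Fixpoint run (c : stmt) (s : state) : state :=
  match c with
  | Asg x e => set_reg s x (ev s e)
  | Put a i e => set_mem s a (ev s i) (ev s e)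
  | Then c1 c2 => run c2 (run c1 s)
  | Cond e c1 c2 => if ev s e =? 0 then run c2 s else run c1 s
  | Nop => s
  end.

Fixpoint stmt_ok (W : nat) (c : stmt) (s : state) : Prop :=
  match c with
  | Asg x e => expr_ok W s e /\ ev s e < 2 ^ W
  | Put a i e => expr_ok W s i /\ expr_ok W s e
  | Then c1 c2 => stmt_ok W c1 s /\ stmt_ok W c2 (run c1 s)
  | Cond e c1 c2 =>
      expr_ok W s e /\
      if ev s e =? 0 then stmt_ok W c2 s else stmt_ok W c1 s
  | Nop => True
  end.

Fixpoint stmt_wf (c : stmt) : bool :=
  match c with
  | Asg x e => is_var x && expr_wf 20 e
  | Put a i e => expr_wf 20 i && expr_wf 21 e
  | Then c1 c2 => stmt_wf c1 && stmt_wf c2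
  | Cond e c1 c2 => expr_wf 20 e && stmt_wf c1 && stmt_wf c2
  | Nop => true
  end.

(** There is no move instruction, so [Or] of a register with itself copies it. It also reduces
    modulo [2 ^ W], which is why [stmt_ok] bounds the value of an assignment. *)
Fixpoint compile (c : stmt) : com :=
  match c with
  | Asg x e => let (c, y) := compile_expr 20 e in Seq c (Op x Or y y)
  | Put a i e =>
      let (c1, y1) := compile_expr 20 i in
      let (c2, y2) := compile_expr 21 e in
      Seq c1 (Seq c2 (Write a y1 y2))
  | Then c1 c2 => Seq (compile c1) (compile c2)
  | Cond e c1 c2 =>
      let (c, y) := compile_expr 20 e in
      Seq c (If y (compile c1) (compile c2))
  | Nop => Skip
  end.

(** Charging both branches of a conditional keeps the bound independent of the state, hence a
    constant for each statement. *)
Fixpoint stmt_cost (c : stmt) : nat :=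
  match c with
  | Asg x e => expr_cost e + 1
  | Put a i e => expr_cost i + (expr_cost e + 1)
  | Then c1 c2 => stmt_cost c1 + stmt_cost c2
  | Cond e c1 c2 => expr_cost e + S (stmt_cost c1 + stmt_cost c2)
  | Nop => 1
  end.

(** [s] and [s'] are only meaningful up to the scratch registers, and [t] is an
    upper bound on the running time. *)
Definition runs (W : nat) (s : state) (c : com) (t : nat) (s' : state) : Prop :=
  forall S, agree S s ->
  exists t' S', exec W c S t' S' /\ t' <= t /\ agree S' s'.

Lemma runs_seq W s1 c1 t1 s2 c2 t2 s3 :
  runs W s1 c1 t1 s2 -> runs W s2 c2 t2 s3 ->
  runs W s1 (Seq c1 c2) (t1 + t2) s3.
Proof.
  intros H1 H2 S hS.
  destruct (H1 S hS) as (u1 & S1 & e1 & l1 & a1).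
  destruct (H2 S1 a1) as (u2 & S2 & e2 & l2 & a2).
  exists (u1 + u2), S2; split; [econstructor; eauto|split; [lia|auto]].
Qed.

Lemma runs_shift W st c t st' s :
  exec W c st t st' -> simulates st s ->
  exists s', runs W s (shift c) t s' /\ simulates st' s' /\ same_low s s'.
Proof.
  intros H [hr hm].
  (* [runs] fixes the final state before the actual start state [S] is known, so it is assembled
     from the low part of [s] and the renamed [st']. *)
  exists (State (fun x => if x <? 40 then reg s x else reg st' (x - 40))
                (fun a i => if a <? 10 then mem s a i else mem st' (a - 10) i)).
  split; [|split].
  - intros S [ar am].
    assert (simulates st S) as hS.
    { split; intros; [rewrite ar, hr by lia|rewrite am, hm]; auto. }
    destruct (exec_shift _ _ _ _ _ H S hS) as (S' & e & [sr sm] & [lr lm]).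
    exists t, S'; split; [auto|split; [auto|split]].
    + intros x hx; cbn [reg]. destruct (Nat.ltb_spec x 40).
      * rewrite lr, ar; auto; lia.
      * rewrite <- sr; f_equal; lia.
    + intros a i; cbn [mem]. destruct (Nat.ltb_spec a 10).
      * rewrite lm, am; auto.
      * rewrite <- sm; f_equal; lia.
  - split; intros; cbn [reg mem].
    + replace (40 + x <? 40) with false by (symmetry; apply Nat.ltb_ge; lia).
      f_equal; lia.
    + replace (10 + a <? 10) with false by (symmetry; apply Nat.ltb_ge; lia).
      f_equal; lia.
  - split; intros; cbn [reg mem].
    + destruct (Nat.ltb_spec x 40); auto; lia.
    + destruct (Nat.ltb_spec a 10); auto; lia.
Qed.

Lemma agree_set_reg S s x v :
  agree S s -> agree (set_reg S x v) (set_reg s x v).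
Proof.
  intros [hr hm]; split; auto; intros y hy; cbn.
  destruct (y =? x); auto.
Qed.

Lemma agree_set_mem S s a i v :
  agree S s -> agree (set_mem S a i v) (set_mem s a i v).
Proof.
  intros [hr hm]; split; auto; intros b j; cbn.
  destruct ((b =? a) && (j =? i))%bool; auto.
Qed.

Lemma runs_compile W c s :
  0 < W -> stmt_wf c = true -> stmt_ok W c s ->
  runs W s (compile c) (stmt_cost c) (run c s).
Proof.
  intros hW; revert s.
  induction c as [x e|a i e|c1 IH1 c2 IH2|e c1 IH1 c2 IH2|]; intros s hw ok;
    cbn in hw, ok |- *.
  - rewrite Bool.andb_true_iff in hw; destruct hw as [h1 h2].
    destruct ok as [o1 o2]. intros S hS.
    destruct (compile_expr_correct W e 20 S) as (t & S' & x1 & l & a & v); auto.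
    { eapply expr_ok_agree; [apply agree_below_sym, hS| | |]; eauto. }
    destruct (compile_expr 20 e) as [c y]; cbn in *.
    exists (t + 1), (set_reg S' x (eval_binop W Or (reg S' y) (reg S' y))).
    split; [econstructor; [eassumption|constructor]|]. split; [lia|].
    unfold eval_binop. rewrite Nat.lor_diag, v.
    rewrite (ev_agree _ _ _ _ _ hS (le_n 20) h2), Nat.mod_small by auto.
    apply agree_set_reg. eapply agree_below_trans; eauto.
  - rewrite Bool.andb_true_iff in hw; destruct hw as [h1 h2].
    destruct ok as [o1 o2]. intros S hS.
    destruct (compile_expr_correct W i 20 S) as (t1 & S1 & x1 & l1 & a1 & v1); auto.
    { eapply expr_ok_agree; [apply agree_below_sym, hS| | |]; eauto. }
    assert (agree S1 s) as hS1 by (eapply agree_below_trans; eauto).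
    destruct (compile_expr_correct W e 21 S1) as (t2 & S2 & x2 & l2 & a2 & v2); auto.
    { eapply expr_ok_agree; [apply agree_below_sym, hS1| | |]; eauto. }
    destruct (compile_expr 20 i) as [c1 y1] eqn:E1.
    destruct (compile_expr 21 e) as [c2 y2]; cbn in *.
    assert (reg S2 y1 = reg S1 y1) as hy.
    { apply a2. pose proof (compile_expr_reg _ _ _ _ E1 h1). lia. }
    exists (t1 + (t2 + 1)), (set_mem S2 a (reg S2 y1) (reg S2 y2)).
    split; [econstructor; [eassumption|econstructor; [eassumption|constructor]]|].
    split; [lia|]. rewrite hy, v1, v2.
    rewrite (ev_agree _ _ _ _ _ hS (le_n 20) h1).
    rewrite (ev_agree _ _ _ _ _ hS1 (le_n 20) h2).
    apply agree_set_mem. eapply agree_below_trans; [|exact hS1].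
    eapply agree_below_weaken; [|exact a2]; lia.
  - rewrite Bool.andb_true_iff in hw; destruct hw, ok.
    eapply runs_seq; auto.
  - rewrite !Bool.andb_true_iff in hw; destruct hw as [[h0 h1] h2].
    destruct ok as [o1 o2]. intros S hS.
    destruct (compile_expr_correct W e 20 S) as (t & S' & x & l & a & v); auto.
    { eapply expr_ok_agree; [apply agree_below_sym, hS| | |]; eauto. }
    destruct (compile_expr 20 e) as [c y]; cbn in *.
    assert (agree S' s) as hS' by (eapply agree_below_trans; eauto).
    rewrite (ev_agree _ _ _ _ _ hS (le_n 20) h0) in v.
    destruct (Nat.eqb_spec (ev s e) 0).
    + destruct (IH2 s h2 o2 S' hS') as (t2 & S2 & x2 & l2 & a2).
      exists (t + Datatypes.S t2), S2; split; [|split; [lia|auto]].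
      econstructor; [eassumption|]. apply exec_if_false; [congruence|auto].
    + destruct (IH1 s h1 o2 S' hS') as (t2 & S2 & x2 & l2 & a2).
      exists (t + Datatypes.S t2), S2; split; [|split; [lia|auto]].
      econstructor; [eassumption|]. apply exec_if_true; [congruence|auto].
  - intros S hS; exists 1, S; repeat split; try apply hS; auto; constructor.
Qed.

(** Runs [body], which must increment register [9], while it is less than
    register [10]. *)
Definition loop (body : com) : com :=
  Seq (Op 20 Lt 9 10) (While 20 (Seq body (Op 20 Lt 9 10))).

(** [I k t s]: the invariant after [k] rounds, the bodies of which took [t]
    steps altogether. *)
Lemma runs_loop W (I : nat -> nat -> state -> Prop) K body s :
  0 < W ->
  (forall k t s, k <= K -> I k t s -> reg s 9 = k /\ reg s 10 = K) ->
  (forall k t s, k < K -> I k t s ->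
     exists t' s', runs W s body t' s' /\ I (S k) (t + t') s') ->
  I 0 0 s ->
  exists t s', runs W s (loop body) (t + 2 * K + 2) s' /\ I K t s'.
Proof.
  intros hW hI hB h0.
  assert (forall k t s S, k <= K -> I k t s -> agree S s ->
    exec W (Op 20 Lt 9 10) S 1 (set_reg S 20 (if k <? K then 1 else 0)) /\
    agree (set_reg S 20 (if k <? K then 1 else 0)) s) as test.
  { intros k t s1 S hk h hS. split.
    - destruct (hI k t s1 hk h) as [e1 e2].
      replace (if k <? K then 1 else 0) with (eval_binop W Lt (reg S 9) (reg S 10)).
      + constructor.
      + rewrite eval_binop_ok by (cbn; auto). destruct hS as [hr _].
        rewrite !hr by lia. now rewrite e1, e2.
    - eapply agree_below_trans; [apply set_reg_agree; lia|exact hS]. }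
  (* Each round adds two steps to its body, the test of [While] and the update of register 20; the
     exit test adds one more. *)
  assert (forall m k t s, k + m = K -> I k t s ->
    exists t' s', I K (t + t') s' /\
      forall S, agree S s -> reg S 20 = (if k <? K then 1 else 0) ->
      exists t'' S', exec W (While 20 (Seq body (Op 20 Lt 9 10))) S t'' S' /\
        t'' <= t' + 2 * m + 1 /\ agree S' s') as H.
  { induction m as [|m IH]; intros k t s1 hk h.
    - exists 0, s1; split.
      + replace (t + 0) with t by lia. now replace K with k by lia.
      + intros S hS hr. exists 1, S. split; [|split; [lia|auto]].
        apply exec_while_false. rewrite hr. destruct (Nat.ltb_spec k K); auto; lia.
    - destruct (hB k t s1 ltac:(lia) h) as (t1 & s2 & r1 & h2).
      destruct (IH (S k) (t + t1) s2 ltac:(lia) h2) as (t2 & s3 & h3 & r3).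
      exists (t1 + t2), s3; split; [now rewrite Nat.add_assoc|].
      intros S hS hr. destruct (r1 S hS) as (u1 & S1 & x1 & l1 & a1).
      destruct (test (Datatypes.S k) _ s2 S1 ltac:(lia) h2 a1) as [x2 a2].
      destruct (r3 _ a2) as (u3 & S3 & x3 & l3 & a3); [cbn; auto|].
      exists (Datatypes.S ((u1 + 1) + u3)), S3. split; [|split; [lia|auto]].
      eapply exec_while_true; [|econstructor; eassumption|exact x3].
      rewrite hr. destruct (Nat.ltb_spec k K); lia. }
  destruct (H K 0 0 s eq_refl h0) as (t & s' & h & r).
  exists t, s'; split; auto. intros S hS.
  destruct (test 0 0 s S ltac:(lia) h0 hS) as [x1 a1].
  destruct (r _ a1) as (u & S' & x & l & a); [cbn; auto|].
  exists (1 + u), S'; split; [econstructor; eauto|split; [lia|auto]].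
Qed.

(** * The layered graph *)

Lemma divmod_eq m q r : r < m -> (q * m + r) / m = q /\ (q * m + r) mod m = r.
Proof.
  intros h; split.
  - rewrite Nat.div_add_l by lia. rewrite Nat.div_small; lia.
  - rewrite Nat.add_comm, Nat.Div0.mod_add. now apply Nat.mod_small.
Qed.

Lemma divmod_lt m q k : k < q * m -> k / m < q /\ k mod m < m.
Proof.
  intros h. assert (m <> 0) by (intros ->; lia).
  split; [|now apply Nat.mod_upper_bound].
  apply Nat.Div0.div_lt_upper_bound. lia.
Qed.

Lemma set_edge_eq g u v o x y :
  set_edge g u v o x y = o /\ (x = u /\ y = v \/ x = v /\ y = u) \/
  set_edge g u v o x y = g x y /\ ~ (x = u /\ y = v \/ x = v /\ y = u).
Proof.
  unfold set_edge. destruct (Nat.eqb_spec x u), (Nat.eqb_spec y v),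
    (Nat.eqb_spec x v), (Nat.eqb_spec y u); cbn; tauto.
Qed.

Lemma nat_lt_cases4 g : g < 4 -> g = 0 \/ g = 1 \/ g = 2 \/ g = 3.
Proof. lia. Qed.

Lemma mul_sub_split c x y z :
  z <= y -> y <= x -> c * (x - z) = c * (x - y) + c * (y - z).
Proof. intros h1 h2. rewrite <- Nat.mul_add_distr_l. f_equal. lia. Qed.

Section LayeredGraph.

Context (n B L M : nat) (wt : nat -> nat -> nat).

(** The layers, in the order in which they are met from the source to the
    target, are numbered 0, 1, 2, 3, 10, 4, 5, 11, 6, 7, 8, 9.  This numbering
    makes the end layers of each of the three edge families affine in [f], [g]
    and [h]. *)
Definition node (l i : nat) : nat := l * n + i.

(** [Fixed f i j]: present from the start.  [Gadget g a c]: for every fixed [a]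
    these edges form, through the nodes [(c + a) mod n] of layers 10 and 11,
    disjoint two-edge paths joining the two copies of [c].  [Hub h a b]: the
    edges that select [b] at both ends of the path. *)
Inductive ledge : Set :=
| Fixed (f i j : nat)
| Gadget (g a c : nat)
| Hub (h a b : nat).

Definition ledge_src (e : ledge) : nat :=
  match e with
  | Fixed f i j => node (2 * f) i
  | Gadget g a c => node (3 + g) c
  | Hub h a b => node (1 + 7 * h) a
  end.

Definition ledge_dst (e : ledge) : nat :=
  match e with
  | Fixed f i j => node (2 * f + 1) j
  | Gadget g a c => node (10 + g / 2) ((c + a) mod n)
  | Hub h a b => node (2 + 5 * h) b
  end.

(** [0 <? f mod 4] selects the families 1, 2, 3, which carry the weights of [bc], [cd], [db]. Of the
    two gadget edges at a middle node only the first carries a pair weight, so each passage is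
    charged once. The case distinctions are 0-1 factors because [gen_edge] evaluates the same
    formulas. *)
Definition ledge_len (e : ledge) : nat :=
  match e with
  | Fixed f i j => M + (if 0 <? f mod 4 then 1 else 0) * wt i j
  | Gadget g a c =>
      M + L * (n - 1 - a) + (if g mod 2 =? 0 then 1 else 0) * wt a c
  | Hub h a b => M + L * (n * n - 1 - (a * n + b))
  end.

Definition ledge_ok (e : ledge) : Prop :=
  match e with
  | Fixed f i j => f < 5 /\ i < n /\ j < n
  | Gadget g a c => g < 4 /\ a < n /\ c < n
  | Hub h a b => h < 2 /\ a < n /\ b < n
  end.

(** The code is the time of insertion: the [5 * (n * n)] fixed edges, then for each [a] a block of
    [4 * n] gadget edges and [2 * n] hub edges. The hub edges of the two ends alternate, so a phase
    [(a, b)] is complete after its second one. *)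
Definition encode (e : ledge) : nat :=
  match e with
  | Fixed f i j => f * (n * n) + (i * n + j)
  | Gadget g a c => 5 * (n * n) + (6 * n * a + (g * n + c))
  | Hub h a b => 5 * (n * n) + (6 * n * a + (4 * n + (2 * b + h)))
  end.

(** The edge inserted in round [k]. *)
Definition decode (k : nat) : ledge :=
  if k <? 5 * (n * n) then
    Fixed (k / (n * n)) (k mod (n * n) / n) (k mod (n * n) mod n)
  else
    let k := k - 5 * (n * n) in
    let a := k / (6 * n) in
    let r := k mod (6 * n) in
    if r <? 4 * n then Gadget (r / n) a (r mod n)
    else Hub ((r - 4 * n) mod 2) a ((r - 4 * n) / 2).

Lemma pair_lt i j : i < n -> j < n -> i * n + j < n * n.
Proof. nia. Qed.

(** The last code belongs to the diagonal pair [(n - 1, n - 1)], so the phase missing from the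
    decremental run never concerns the first two vertices of a clique. *)
Lemma pair_lt_last i j : i < n -> j < n -> i <> j -> i * n + j < n * n - 1.
Proof.
  intros hi hj h. destruct (Nat.eq_dec i (n - 1)); [|nia].
  assert (j < n - 1) by lia. nia.
Qed.

Lemma decode_ok k : k < 11 * (n * n) -> ledge_ok (decode k).
Proof.
  intros hk. unfold decode. destruct (Nat.ltb_spec k (5 * (n * n))) as [h|h];
    cbn [ledge_ok].
  - destruct (divmod_lt (n * n) 5 k h) as [h1 h2].
    destruct (divmod_lt n n _ h2). auto.
  - destruct (divmod_lt (6 * n) n (k - 5 * (n * n))) as [h1 h2]; [lia|].
    set (r := (k - 5 * (n * n)) mod (6 * n)) in *.
    destruct (Nat.ltb_spec r (4 * n)) as [h3|h3]; cbn [ledge_ok].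
    + destruct (divmod_lt n 4 r h3). auto.
    + split; [apply Nat.mod_upper_bound; lia|split; auto].
      apply Nat.Div0.div_lt_upper_bound. lia.
Qed.

Lemma encode_decode k : encode (decode k) = k.
Proof.
  unfold decode. destruct (Nat.ltb_spec k (5 * (n * n))) as [h|h]; cbn [encode].
  - pose proof (Nat.div_mod_eq k (n * n)).
    pose proof (Nat.div_mod_eq (k mod (n * n)) n). lia.
  - pose proof (Nat.div_mod_eq (k - 5 * (n * n)) (6 * n)) as e.
    set (r := (k - 5 * (n * n)) mod (6 * n)) in *.
    destruct (Nat.ltb_spec r (4 * n)) as [h3|h3]; cbn [encode].
    + pose proof (Nat.div_mod_eq r n). lia.
    + pose proof (Nat.div_mod_eq (r - 4 * n) 2). lia.
Qed.

Lemma decode_encode e : ledge_ok e -> decode (encode e) = e.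
Proof.
  destruct e; cbn [encode ledge_ok]; intros (h1 & h2 & h3); unfold decode.
  - pose proof (pair_lt i j h2 h3) as h4.
    destruct (Nat.ltb_spec (f * (n * n) + (i * n + j)) (5 * (n * n))); [|nia].
    destruct (divmod_eq (n * n) f (i * n + j) h4) as [-> ->].
    destruct (divmod_eq n i j h3) as [-> ->]. reflexivity.
  - destruct (Nat.ltb_spec (5 * (n * n) + (6 * n * a + (g * n + c))) (5 * (n * n)));
      [lia|].
    assert (g * n + c < 4 * n) as h4 by nia.
    replace (5 * (n * n) + (6 * n * a + (g * n + c)) - 5 * (n * n))
      with (a * (6 * n) + (g * n + c)) by lia.
    destruct (divmod_eq (6 * n) a (g * n + c) ltac:(lia)) as [-> ->].
    destruct (Nat.ltb_spec (g * n + c) (4 * n)); [|lia].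
    destruct (divmod_eq n g c h3) as [-> ->]. reflexivity.
  - destruct (Nat.ltb_spec
      (5 * (n * n) + (6 * n * a + (4 * n + (2 * b + h)))) (5 * (n * n))); [lia|].
    replace (5 * (n * n) + (6 * n * a + (4 * n + (2 * b + h))) - 5 * (n * n))
      with (a * (6 * n) + (4 * n + (2 * b + h))) by lia.
    destruct (divmod_eq (6 * n) a (4 * n + (2 * b + h)) ltac:(lia)) as [-> ->].
    destruct (Nat.ltb_spec (4 * n + (2 * b + h)) (4 * n)); [lia|].
    replace (4 * n + (2 * b + h) - 4 * n) with (b * 2 + h) by lia.
    destruct (divmod_eq 2 b h h1) as [-> ->]. reflexivity.
Qed.

Lemma node_inj l i l' i' :
  i < n -> i' < n -> node l i = node l' i' -> l = l' /\ i = i'.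
Proof.
  unfold node; intros h h' e.
  destruct (divmod_eq n l i h) as [h1 h2].
  destruct (divmod_eq n l' i' h') as [h1' h2'].
  rewrite e in h1, h2. split; congruence.
Qed.

(** Addition modulo [n] is a Latin square. Injectivity in [a] keeps the gadget edges of different
    phases apart; read with the summands exchanged, it forces a path to leave a middle node towards
    the [c] from which it came. *)
Lemma latin_inj c a a' :
  a < n -> a' < n -> c < n -> (c + a) mod n = (c + a') mod n -> a = a'.
Proof.
  intros h h' hc e.
  assert (forall x, x < n -> (c + x) mod n = if c + x <? n then c + x else c + x - n) as H.
  { intros x hx. destruct (Nat.ltb_spec (c + x) n); [now apply Nat.mod_small|].
    replace (c + x) with (1 * n + (c + x - n)) at 1 by lia.
    apply divmod_eq; lia. }
  rewrite !H in e by auto.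
  destruct (Nat.ltb_spec (c + a) n), (Nat.ltb_spec (c + a') n); lia.
Qed.

Definition ends_idx (e : ledge) : nat * nat * nat * nat :=
  match e with
  | Fixed f i j => (2 * f, i, 2 * f + 1, j)
  | Gadget g a c => (3 + g, c, 10 + g / 2, (c + a) mod n)
  | Hub h a b => (1 + 7 * h, a, 2 + 5 * h, b)
  end.

Lemma ends_idx_spec e :
  ledge_ok e ->
  let '(l, i, l', i') := ends_idx e in
  ledge_src e = node l i /\ ledge_dst e = node l' i' /\ i < n /\ i' < n /\ l < 12 /\ l' < 12.
Proof.
  destruct e; cbn [ends_idx ledge_ok ledge_src ledge_dst]; intros (h1 & h2 & h3);
    repeat split; try lia.
  - apply Nat.mod_upper_bound; lia.
  - assert (g / 2 < 2) by (apply Nat.Div0.div_lt_upper_bound; lia). lia.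
Qed.

(** The eleven families join different pairs of layers, and inside a family the two indices
    determine the edge. This is what makes every pair of nodes occur in at most one insertion. *)
Lemma ends_inj e e' :
  ledge_ok e -> ledge_ok e' ->
  ledge_src e = ledge_src e' /\ ledge_dst e = ledge_dst e' \/
  ledge_src e = ledge_dst e' /\ ledge_dst e = ledge_src e' ->
  e = e'.
Proof.
  intros he he' H.
  pose proof (ends_idx_spec e he) as S. pose proof (ends_idx_spec e' he') as S'.
  destruct (ends_idx e) as [[[l1 i1] l2] i2] eqn:E.
  destruct (ends_idx e') as [[[l1' i1'] l2'] i2'] eqn:E'.
  destruct S as (s1 & s2 & b1 & b2 & _), S' as (s1' & s2' & b1' & b2' & _).
  rewrite s1, s2, s1', s2' in H. clear s1 s2 s1' s2'.
  assert ((l1 = l1' /\ i1 = i1') /\ (l2 = l2' /\ i2 = i2') \/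
          (l1 = l2' /\ i1 = i2') /\ (l2 = l1' /\ i2 = i1')) as K.
  { destruct H as [[h1 h2]|[h1 h2]]; [left|right]; split; apply node_inj; auto. }
  clear H. revert E E' he he'.
  destruct e as [f i j|g a c|h a b], e' as [f' i' j'|g' a' c'|h' a' b'];
    cbn [ends_idx ledge_ok]; intros E E' he he';
    injection E as <- <- <- <-; injection E' as <- <- <- <-;
    try (destruct (nat_lt_cases4 g) as [-> | [-> | [-> | ->]]]; [tauto|..];
         cbn [Nat.div Nat.divmod fst] in K);
    try (destruct (nat_lt_cases4 g') as [-> | [-> | [-> | ->]]]; [tauto|..];
         cbn [Nat.div Nat.divmod fst] in K);
    try lia;
    try (f_equal; lia).
  (* What remains are two edges of one gadget family with the same [c]; the middle node then
     determines [a]. *)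
  all: destruct K as [[[_ <-] [_ K]]|K]; [|lia]; f_equal;
    eapply latin_inj; try exact K; tauto.
Qed.

(** * The graph after [k] insertions *)

Fixpoint stage (k : nat) : wgraph :=
  match k with
  | 0 => empty_graph
  | S k => set_edge (stage k) (ledge_src (decode k)) (ledge_dst (decode k))
                    (Some (ledge_len (decode k)))
  end.

Lemma stage_inv k u v w :
  k <= 11 * (n * n) -> stage k u v = Some w ->
  exists e, ledge_ok e /\ encode e < k /\ w = ledge_len e /\
    (u = ledge_src e /\ v = ledge_dst e \/ u = ledge_dst e /\ v = ledge_src e).
Proof.
  induction k as [|k IH]; cbn [stage]; intros hk; [discriminate|].
  destruct (set_edge_eq (stage k) (ledge_src (decode k)) (ledge_dst (decode k))
              (Some (ledge_len (decode k))) u v) as [[-> h]|[-> _]]; intros H.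
  - injection H as <-. exists (decode k).
    rewrite encode_decode. repeat split; auto. apply decode_ok; lia.
  - destruct (IH ltac:(lia) H) as (e & h1 & h2 & h3).
    exists e; repeat split; auto; try lia; tauto.
Qed.

(** By [ends_inj] no later insertion touches the same pair of nodes, so an edge keeps its weight. *)
Lemma stage_edge k e :
  k <= 11 * (n * n) -> ledge_ok e -> encode e < k ->
  stage k (ledge_src e) (ledge_dst e) = Some (ledge_len e) /\
  stage k (ledge_dst e) (ledge_src e) = Some (ledge_len e).
Proof.
  intros hk he. induction k as [|k IH]; cbn [stage]; intros hek; [lia|].
  assert (decode k = e \/ encode e < k) as [<-|h].
  { destruct (Nat.eq_dec (encode e) k) as [<-|]; [left; now apply decode_encode|lia]. }
  - split.
    + destruct (set_edge_eq (stage k) (ledge_src (decode k)) (ledge_dst (decode k))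
        (Some (ledge_len (decode k))) (ledge_src (decode k)) (ledge_dst (decode k)))
        as [[-> _]|[_ ?]];
        tauto.
    + destruct (set_edge_eq (stage k) (ledge_src (decode k)) (ledge_dst (decode k))
        (Some (ledge_len (decode k))) (ledge_dst (decode k)) (ledge_src (decode k)))
        as [[-> _]|[_ ?]];
        tauto.
  - destruct (IH ltac:(lia) h) as [h1 h2].
    assert (~ (ledge_src e = ledge_src (decode k) /\ ledge_dst e = ledge_dst (decode k) \/
               ledge_src e = ledge_dst (decode k) /\ ledge_dst e = ledge_src (decode k)))
      as hne.
    { intros hh. apply ends_inj in hh; auto; [|apply decode_ok; lia].
      subst e. rewrite encode_decode in h. lia. }
    split.
    + destruct (set_edge_eq (stage k) (ledge_src (decode k)) (ledge_dst (decode k))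
        (Some (ledge_len (decode k))) (ledge_src e) (ledge_dst e)) as [[_ ?]|[-> _]]; tauto.
    + destruct (set_edge_eq (stage k) (ledge_src (decode k)) (ledge_dst (decode k))
        (Some (ledge_len (decode k))) (ledge_dst e) (ledge_src e)) as [[_ ?]|[-> _]]; tauto.
Qed.

Lemma stage_fresh k :
  k < 11 * (n * n) -> stage k (ledge_src (decode k)) (ledge_dst (decode k)) = None.
Proof.
  intros hk.
  destruct (stage k (ledge_src (decode k)) (ledge_dst (decode k))) eqn:E; auto.
  apply stage_inv in E; [|lia]. destruct E as (e & h1 & h2 & _ & h).
  apply ends_inj in h; auto; [|apply decode_ok; lia].
  subst e. rewrite encode_decode in h2. lia.
Qed.

Lemma ends_bound e :
  ledge_ok e -> ledge_src e < 12 * n /\ ledge_dst e < 12 * n /\ ledge_src e <> ledge_dst e.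
Proof.
  intros he. pose proof (ends_idx_spec e he) as S.
  assert (let '(l, _, l', _) := ends_idx e in l <> l').
  { destruct e as [f i j|g a c|h a b]; cbn; cbn in he; lia. }
  destruct (ends_idx e) as [[[l1 i1] l2] i2].
  destruct S as (-> & -> & b1 & b2 & b3 & b4). repeat split.
  - unfold node; nia.
  - unfold node; nia.
  - intros E. apply node_inj in E; lia.
Qed.

Lemma stage_is_graph k : k <= 11 * (n * n) -> is_graph (12 * n) (stage k).
Proof.
  intros hk. repeat split.
  - apply stage_inv in H; auto. destruct H as (e & he & _ & _ & h).
    pose proof (ends_bound e he). lia.
  - apply stage_inv in H; auto. destruct H as (e & he & _ & _ & h).
    pose proof (ends_bound e he). lia.
  - intros u v. clear hk. induction k as [|k IH]; cbn [stage]; auto.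
    unfold set_edge. rewrite IH, Bool.orb_comm.
    rewrite (Bool.andb_comm (u =? _)), (Bool.andb_comm (u =? _)). reflexivity.
  - intros u. destruct (stage k u u) eqn:E; auto.
    apply stage_inv in E; auto. destruct E as (e & he & _ & _ & h).
    pose proof (ends_bound e he). lia.
Qed.

(** The number of insertions after which phase [(a, b)] is complete. *)
Definition phase_end (a b : nat) : nat :=
  5 * (n * n) + (6 * n * a + (4 * n + (2 * b + 2))).

Definition layer (k : nat) : nat := nth k [0; 1; 2; 3; 10; 4; 5; 11; 6; 7; 8; 9] 0.

(** The edges present at the end of phase [(a, b)] that lead from node [i] of the
    [k]-th layer on the path to node [j] of the next one, with their weights. *)
Definition forward (a b k i j w : nat) : Prop :=
  match k with
  | 0 | 10 => w = M
  | 1 => i * n + j <= a * n + b /\ w = M + L * (n * n - 1 - (i * n + j))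
  | 9 => j * n + i <= a * n + b /\ w = M + L * (n * n - 1 - (j * n + i))
  | 2 | 5 | 8 => w = M + wt i j
  | 3 | 6 => exists a', a' <= a /\ a' < n /\ j = (i + a') mod n /\
                        w = M + L * (n - 1 - a') + wt a' i
  | 4 | 7 => exists a', a' <= a /\ a' < n /\ i = (j + a') mod n /\
                        w = M + L * (n - 1 - a')
  | _ => False
  end.

Lemma len_Fixed f i j :
  f < 5 ->
  ledge_len (Fixed f i j) = M + match f with 0 | 4 => 0 | _ => wt i j end.
Proof.
  intros hf.
  do 5 (destruct f as [|f]; [unfold ledge_len;
    match goal with |- context [0 <? ?x] =>
      let v := eval vm_compute in (0 <? x) in change (0 <? x) with v
    end; cbv iota; lia|]). lia.
Qed.

Lemma len_Gadget g a c :
  g < 4 ->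
  ledge_len (Gadget g a c) =
    M + L * (n - 1 - a) + match g with 0 | 2 => wt a c | _ => 0 end.
Proof.
  intros hg.
  do 4 (destruct g as [|g]; [unfold ledge_len;
    match goal with |- context [?x =? 0] =>
      let v := eval vm_compute in (x =? 0) in change (x =? 0) with v
    end; cbv iota; lia|]). lia.
Qed.

Lemma phase_end_le a b : a < n -> b < n -> phase_end a b <= 11 * (n * n).
Proof. unfold phase_end; intros; nia. Qed.

Lemma stage_forward a b u v w :
  a < n -> b < n -> stage (phase_end a b) u v = Some w ->
  exists k i j, i < n /\ j < n /\ forward a b k i j w /\
    (u = node (layer k) i /\ v = node (layer (S k)) j \/
     u = node (layer (S k)) j /\ v = node (layer k) i).
Proof.
  intros ha hb H. apply stage_inv in H; [|now apply phase_end_le].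
  destruct H as ([f i j|g a' c|h a' b'] & he & hk & -> & H);
    cbn [ledge_ok] in he; destruct he as (h1 & h2 & h3);
    cbn [ledge_src ledge_dst] in H; unfold phase_end in hk; cbn [encode] in hk.
  (* The fixed families sit at positions 0, 2, 5, 8, 10 of the path, the gadgets at 3, 4, 6, 7 and
     the hubs at 1 and 9. *)
  - assert (f = 0 \/ f = 1 \/ f = 2 \/ f = 3 \/ f = 4) as K by lia.
    destruct K as [-> | [-> | [-> | [-> | ->]]]];
      [exists 0|exists 2|exists 5|exists 8|exists 10]; exists i, j;
      rewrite len_Fixed by lia; repeat split; auto; first [exact H|cbn [forward]; lia].
  - assert (a' <= a) by nia.
    assert ((c + a') mod n < n) by (apply Nat.mod_upper_bound; lia).
    destruct (nat_lt_cases4 g h1) as [-> | [-> | [-> | ->]]].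
    + exists 3, c, ((c + a') mod n); repeat split; auto.
      exists a'; rewrite len_Gadget; auto.
    (* Odd gadget families are oriented towards the middle node, against the direction of the path,
       hence the exchanged ends; the second hub family is treated alike. *)
    + exists 4, ((c + a') mod n), c; repeat split; auto; [|now apply or_comm].
      exists a'; rewrite len_Gadget; auto.
    + exists 6, c, ((c + a') mod n); repeat split; auto.
      exists a'; rewrite len_Gadget; auto.
    + exists 7, ((c + a') mod n), c; repeat split; auto; [|now apply or_comm].
      exists a'; rewrite len_Gadget; auto.
  - assert (a' < a \/ a' = a /\ b' <= b) as K.
    { destruct (Nat.lt_trichotomy a' a) as [?|[->|?]]; [auto|right; lia|nia]. }
    assert (a' * n + b' <= a * n + b) by (destruct K as [K|[-> K]]; nia).
    assert (h = 0 \/ h = 1) as [-> | ->] by lia.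
    + exists 1, a', b'; repeat split; auto.
    + exists 9, b', a'; repeat split; auto. now apply or_comm.
Qed.

Lemma forward_stage a b k i j w :
  a < n -> b < n -> i < n -> j < n -> forward a b k i j w ->
  stage (phase_end a b) (node (layer k) i) (node (layer (S k)) j) = Some w.
Proof.
  intros ha hb hi hj H. pose proof (phase_end_le a b ha hb) as hp.
  assert (forall f, f < 5 -> encode (Fixed f i j) < phase_end a b) as h1.
  { intros f hf. unfold phase_end; cbn [encode]. pose proof (pair_lt i j hi hj). nia. }
  assert (forall g a' c, g < 4 -> a' <= a -> c < n ->
            encode (Gadget g a' c) < phase_end a b) as h2.
  { intros g a' c hg ha' hc. unfold phase_end; cbn [encode].
    assert (g * n + c < 4 * n) by nia. nia. }
  assert (forall h a' b', h < 2 -> a' < n -> b' < n -> a' * n + b' <= a * n + b ->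
            encode (Hub h a' b') < phase_end a b) as h3.
  { intros h a' b' hh h4 h5 h6. unfold phase_end; cbn [encode].
    assert (a' < a \/ a' = a /\ b' <= b) as [h7|[-> h7]] by nia; nia. }
  destruct k as [|[|[|[|[|[|[|[|[|[|[|k]]]]]]]]]]]; cbn [forward] in H.
  - subst w.
    destruct (stage_edge _ (Fixed 0 i j) hp ltac:(cbn; lia) (h1 0 ltac:(lia))) as [E _].
    rewrite len_Fixed, Nat.add_0_r in E by lia. exact E.
  - destruct H as [h4 ->].
    apply (stage_edge _ (Hub 0 i j) hp); [cbn; lia|apply h3; auto].
  - subst w.
    destruct (stage_edge _ (Fixed 1 i j) hp ltac:(cbn; lia) (h1 1 ltac:(lia))) as [E _].
    rewrite len_Fixed in E by lia. exact E.
  - destruct H as (a' & h4 & h5 & -> & ->).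
    destruct (stage_edge _ (Gadget 0 a' i) hp ltac:(cbn; lia)
      (h2 0 a' i ltac:(lia) h4 hi)) as [E _].
    rewrite len_Gadget in E by lia. exact E.
  - destruct H as (a' & h4 & h5 & -> & ->).
    destruct (stage_edge _ (Gadget 1 a' j) hp ltac:(cbn; lia)
      (h2 1 a' j ltac:(lia) h4 hj)) as [_ E].
    rewrite len_Gadget, Nat.add_0_r in E by lia. exact E.
  - subst w.
    destruct (stage_edge _ (Fixed 2 i j) hp ltac:(cbn; lia) (h1 2 ltac:(lia))) as [E _].
    rewrite len_Fixed in E by lia. exact E.
  - destruct H as (a' & h4 & h5 & -> & ->).
    destruct (stage_edge _ (Gadget 2 a' i) hp ltac:(cbn; lia)
      (h2 2 a' i ltac:(lia) h4 hi)) as [E _].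
    rewrite len_Gadget in E by lia. exact E.
  - destruct H as (a' & h4 & h5 & -> & ->).
    destruct (stage_edge _ (Gadget 3 a' j) hp ltac:(cbn; lia)
      (h2 3 a' j ltac:(lia) h4 hj)) as [_ E].
    rewrite len_Gadget, Nat.add_0_r in E by lia. exact E.
  - subst w.
    destruct (stage_edge _ (Fixed 3 i j) hp ltac:(cbn; lia) (h1 3 ltac:(lia))) as [E _].
    rewrite len_Fixed in E by lia. exact E.
  - destruct H as [h4 ->].
    apply (stage_edge _ (Hub 1 j i) hp); [cbn; lia|apply h3; auto].
  - subst w.
    destruct (stage_edge _ (Fixed 4 i j) hp ltac:(cbn; lia) (h1 4 ltac:(lia))) as [E _].
    rewrite len_Fixed, Nat.add_0_r in E by lia. exact E.
  - destruct H.
Qed.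

(** * Forward paths and the distances at the ends of phases *)

Inductive forward_path (a b : nat) : nat -> nat -> nat -> Prop :=
| forward_end : forward_path a b 11 0 0
| forward_step k i j w l :
    i < n -> j < n -> forward a b k i j w -> forward_path a b (S k) j l ->
    forward_path a b k i (w + l).

Lemma forward_ge a b k i j w : forward a b k i j w -> k < 11 /\ M <= w.
Proof.
  destruct k as [|[|[|[|[|[|[|[|[|[|[|k]]]]]]]]]]]; cbn [forward]; intros H;
    repeat match goal with
           | H : exists _, _ |- _ => destruct H
           | H : _ /\ _ |- _ => destruct H
           end; solve [contradiction|lia|
             subst w; split; [lia|]; rewrite <- ?Nat.add_assoc; apply Nat.le_add_r].
Qed.

Lemma forward_path_ge a b k i l :
  forward_path a b k i l -> k <= 11 /\ (11 - k) * M <= l.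
Proof.
  induction 1 as [|k i j w l hi hj hf _ [h1 h2]]; [lia|].
  apply forward_ge in hf. split; [lia|].
  replace (11 - k) with (S (11 - S k)) by lia. lia.
Qed.

Lemma forward_path_walk a b k i l :
  a < n -> b < n -> forward_path a b k i l ->
  walk (stage (phase_end a b)) (node (layer k) i) (9 * n) l.
Proof.
  intros ha hb. induction 1 as [|k i j w l hi hj hf _ IH].
  - replace (node (layer 11) 0) with (9 * n) by (unfold node, layer; cbn [nth]; lia).
    constructor.
  - econstructor; [|exact IH]. now apply forward_stage.
Qed.

Lemma layer_inj k k' : k <= 11 -> k' <= 11 -> layer k = layer k' -> k = k'.
Proof.
  (* The list is the inverse of the permutation in [layer]. *)
  assert (forall k, k <= 11 ->
    nth (layer k) [0; 1; 2; 3; 5; 6; 8; 9; 10; 11; 4; 7] 0 = k) as H.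
  { intros m hm. do 12 (destruct m as [|m]; [reflexivity|]). lia. }
  intros h h' e. rewrite <- (H k h), <- (H k' h'), e. reflexivity.
Qed.

(** A walk that leaves the forward direction needs at least one edge more, hence
    costs at least one [M] more. *)
Lemma walk_forward_path a b x z l :
  a < n -> b < n -> walk (stage (phase_end a b)) x z l ->
  forall k i, z = 9 * n -> k <= 11 -> i < n -> x = node (layer k) i ->
  forward_path a b k i l \/ (12 - k) * M <= l.
Proof.
  intros ha hb. induction 1 as [x|x y z w l hw _ IH]; intros k i hz hk hi hx.
  - left. replace (9 * n) with (node (layer 11) 0) in hz
      by (unfold node, layer; cbn [nth]; lia).
    rewrite hz in hx. apply node_inj in hx; [|lia|auto]. destruct hx as [e <-].
    apply layer_inj in e; auto. subst k. constructor.
  - apply stage_forward in hw; auto.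
    destruct hw as (k' & i' & j & hi' & hj & hf & [[-> hy]|[-> hy]]);
      pose proof (forward_ge _ _ _ _ _ _ hf) as [hk' hM];
      apply node_inj in hx; auto; destruct hx as [e ->];
      apply layer_inj in e; try lia; subst k.
    + destruct (IH (S k') j hz ltac:(lia) hj hy) as [h|h].
      * left. now apply forward_step with j.
      * right. replace (12 - k') with (S (12 - S k')) by lia. lia.
    (* After a step back to position [k'] the rest of the walk alone costs [(11 - k') * M], which is
       the bound claimed at position [S k']. *)
    + right. destruct (IH k' i' hz ltac:(lia) hi' hy) as [h|h].
      * apply forward_path_ge in h as [_ h].
        replace (12 - S k') with (11 - k') by lia. lia.
      * replace (12 - k') with (S (12 - S k')) in h by lia. lia.
Qed.

Definition base (a b : nat) : nat :=
  11 * M + L * (2 * (n * n - 1 - (a * n + b)) + 4 * (n - 1 - a)).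

Definition rest (a b c d : nat) : nat :=
  wt b c + wt a c + wt c d + wt a d + wt d b.

Lemma forward_path_rest a b c d :
  a < n -> b < n -> c < n -> d < n ->
  forward_path a b 0 0 (base a b + rest a b c d).
Proof.
  intros ha hb hc hd.
  assert (forall x, (x + a) mod n < n) as hm by (intros; apply Nat.mod_upper_bound; lia).
  replace (base a b + rest a b c d) with
    (M + (M + L * (n * n - 1 - (a * n + b)) + (M + wt b c +
     (M + L * (n - 1 - a) + wt a c + (M + L * (n - 1 - a) + (M + wt c d +
     (M + L * (n - 1 - a) + wt a d + (M + L * (n - 1 - a) + (M + wt d b +
     (M + L * (n * n - 1 - (a * n + b)) + (M + 0)))))))))))
    by (unfold base, rest; lia).
  apply forward_step with a; [lia|auto|reflexivity|].
  apply forward_step with b; [auto|auto|split; auto|].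
  apply forward_step with c; [auto|auto|reflexivity|].
  apply forward_step with ((c + a) mod n); [auto|auto|exists a; auto|].
  apply forward_step with c; [auto|auto|exists a; auto|].
  apply forward_step with d; [auto|auto|reflexivity|].
  apply forward_step with ((d + a) mod n); [auto|auto|exists a; auto|].
  apply forward_step with d; [auto|auto|exists a; auto|].
  apply forward_step with b; [auto|auto|reflexivity|].
  apply forward_step with a; [auto|auto|split; auto|].
  apply forward_step with 0; [auto|lia|reflexivity|].
  constructor.
Qed.

Lemma forward_path_inv a b k i l :
  forward_path a b k i l -> k <> 11 ->
  exists j w l', j < n /\ forward a b k i j w /\ forward_path a b (S k) j l' /\ l = w + l'.
Proof.
  destruct 1 as [|k i j w l hi hj hf hp]; intros hk; [lia|].
  exists j, w, l; auto.
Qed.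

(** Every hub or gadget edge of an earlier phase costs at least [L] more than the
    one of phase [(a, b)]. *)
Lemma forward_path_short a b l :
  a < n -> b < n -> 5 * B < L -> forward_path a b 0 0 l -> l <= base a b + 5 * B ->
  exists c d, c < n /\ d < n /\ l = base a b + rest a b c d.
Proof.
  intros ha hb hL H hl.
  assert (a <= n - 1) as han by lia.
  assert (a * n + b <= n * n - 1) as hab by (pose proof (pair_lt a b ha hb); lia).
  apply forward_path_inv in H as (j1 & w0 & l0 & b1 & f0 & H & ->); [|lia].
  apply forward_path_inv in H as (j2 & w1 & l1 & b2 & f1 & H & ->); [|lia].
  apply forward_path_inv in H as (j3 & w2 & l2 & b3 & f2 & H & ->); [|lia].
  apply forward_path_inv in H as (j4 & w3 & l3 & b4 & f3 & H & ->); [|lia].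
  apply forward_path_inv in H as (j5 & w4 & l4 & b5 & f4 & H & ->); [|lia].
  apply forward_path_inv in H as (j6 & w5 & l5 & b6 & f5 & H & ->); [|lia].
  apply forward_path_inv in H as (j7 & w6 & l6 & b7 & f6 & H & ->); [|lia].
  apply forward_path_inv in H as (j8 & w7 & l7 & b8 & f7 & H & ->); [|lia].
  apply forward_path_inv in H as (j9 & w8 & l8 & b9 & f8 & H & ->); [|lia].
  apply forward_path_inv in H as (j10 & w9 & l9 & b10 & f9 & H & ->); [|lia].
  apply forward_path_inv in H as (j11 & w10 & l10 & b11 & f10 & H & ->); [|lia].
  inversion H as [e1 e2 e3|? ? ? ? ? _ _ hF]; [|destruct hF]. subst j11 l10. clear H.
  cbn [forward] in *. subst w0 w2 w5 w8 w10.
  destruct f1 as [p1 ->], f9 as [p2 ->].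
  destruct f3 as (a1 & q1 & r1 & s1 & ->), f4 as (a2 & q2 & r2 & s2 & ->),
    f6 as (a3 & q3 & r3 & s3 & ->), f7 as (a4 & q4 & r4 & s4 & ->).
  assert (forall x, L * x <= 5 * B -> x = 0) as small.
  { intros [|x]; auto. rewrite Nat.mul_succ_r. lia. }
  (* Each penalty splits into that of the current phase, which cancels against [base], and a
     surplus. The surpluses together are at most [5 * B < L], hence all vanish. *)
  unfold base in hl.
  rewrite Nat.mul_add_distr_l, !(Nat.mul_shuffle3 L) in hl.
  pose proof (mul_sub_split L _ _ _ p1 hab) as t1.
  pose proof (mul_sub_split L _ _ _ p2 hab) as t2.
  pose proof (mul_sub_split L _ _ _ q1 han) as t3.
  pose proof (mul_sub_split L _ _ _ q2 han) as t4.
  pose proof (mul_sub_split L _ _ _ q3 han) as t5.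
  pose proof (mul_sub_split L _ _ _ q4 han) as t6.
  rewrite t1, t2, t3, t4, t5, t6 in hl |- *. clear t1 t2 t3 t4 t5 t6.
  assert (L * (a * n + b - (j1 * n + j2)) <= 5 * B /\
          L * (a * n + b - (j10 * n + j9)) <= 5 * B /\
          L * (a - a1) <= 5 * B /\ L * (a - a2) <= 5 * B /\
          L * (a - a3) <= 5 * B /\ L * (a - a4) <= 5 * B) as hs.
  { repeat match type of hl with context [L * ?x] =>
      let y := fresh "y" in set (y := L * x) in *; clearbody y end. lia. }
  destruct hs as (z1 & z2 & z3 & z4 & z5 & z6).
  apply small in z1, z2, z3, z4, z5, z6.
  rewrite z1, z2, z3, z4, z5, z6.
  assert (a1 = a) by lia. assert (a2 = a) by lia.
  assert (a3 = a) by lia. assert (a4 = a) by lia. subst a1 a2 a3 a4.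
  destruct (node_inj a b j1 j2) as [<- <-]; auto; [unfold node; lia|].
  destruct (node_inj a b j10 j9) as [<- <-]; auto; [unfold node; lia|].
  (* Both edges at a middle node now belong to phase [a], so the node determines the same [c] on
     either side; likewise for [d]. *)
  rewrite s1, !(Nat.add_comm _ a) in s2. apply latin_inj in s2; auto.
  rewrite s3, !(Nat.add_comm _ a) in s4. apply latin_inj in s4; auto.
  subst j5 j8. exists j3, j6; repeat split; auto. unfold base, rest. lia.
Qed.

Lemma dist_phase a b D :
  a < n -> b < n -> (forall i j, i < n -> j < n -> wt i j <= B) ->
  5 * B < L -> 7 * (n * n) * L <= M ->
  is_dist (stage (phase_end a b)) 0 (9 * n) D ->
  (exists c d, c < n /\ d < n /\ D = base a b + rest a b c d) /\
  (forall c d, c < n -> d < n -> D <= base a b + rest a b c d).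
Proof.
  intros ha hb hB hL hM [hw hmin].
  assert (forall c d, c < n -> d < n -> D <= base a b + rest a b c d) as hle.
  { intros c d hc hd. apply hmin.
    apply (forward_path_walk a b 0 0); auto. now apply forward_path_rest. }
  split; auto.
  (* Any [c] and [d] give a path, so the choice of 0 for both provides an a priori bound on the
     distance. *)
  assert (rest a b 0 0 <= 5 * B) as h0.
  { unfold rest. assert (0 < n) as h by lia.
    pose proof (hB b 0 hb h). pose proof (hB a 0 ha h).
    pose proof (hB 0 0 h h). pose proof (hB 0 b h hb). lia. }
  pose proof (hle 0 0 ltac:(lia) ltac:(lia)) as hD.
  apply forward_path_short; auto; [|lia].
  destruct (walk_forward_path a b _ _ _ ha hb hw 0 0) as [h|h]; auto; try lia.
  exfalso. unfold base in hD.
  (* The penalties and the slack [5 * B < L] fit into a single [M], which rules out a length of at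
     least [12 * M]. *)
  assert (L * (2 * (n * n - 1 - (a * n + b)) + 4 * (n - 1 - a)) + L <= 7 * (n * n) * L).
  { replace (L * (2 * (n * n - 1 - (a * n + b)) + 4 * (n - 1 - a)) + L) with
      ((2 * (n * n - 1 - (a * n + b)) + 4 * (n - 1 - a) + 1) * L) by lia.
    apply Nat.mul_le_mono_r. nia. }
  lia.
Qed.

(** Excludes, at the end of a phase, the report that the target is unreachable. *)
Lemma phase_connected a b :
  a < n -> b < n -> exists l, walk (stage (phase_end a b)) 0 (9 * n) l.
Proof.
  intros ha hb. exists (base a b + rest a b 0 0).
  apply (forward_path_walk a b 0 0); auto. apply forward_path_rest; auto; lia.
Qed.

End LayeredGraph.

(** * The programs *)

Declare Scope expr_scope.
Bind Scope expr_scope with expr.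
Delimit Scope expr_scope with expr.
Local Notation "a + b" := (E Add a b) : expr_scope.
Local Notation "a - b" := (E Sub a b) : expr_scope.
Local Notation "a * b" := (E Mul a b) : expr_scope.
Local Notation "a / b" := (E Div a b) : expr_scope.
Local Notation "a 'mod' b" := (E Mod a b) : expr_scope.
Local Notation "a <? b" := (E Lt a b) : expr_scope.
Local Notation "a =? b" := (E Eq a b) : expr_scope.
Local Notation "x ::= e" := (Asg x e%expr) (at level 75).
Local Infix ";;" := Then (at level 80, right associativity).

(** Register conventions: 0 is [n], 5 is [n * n], 6 is [L], 7 is [M], 8 is [B];
    9 and 10 are the counter and the bound of the current loop; 17 is the round
    whose edge is computed into 11, 12 (ends) and 13 (weight); 14 and 15 are the
    current minimum and its index.  Array 2 holds the completed weight matrix,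
    array 3 the reported distances. *)
Definition gen_edge : stmt :=
  Cond (V 17 <? C 5 * V 5)
    (18 ::= V 17 / V 5;;
     19 ::= V 17 mod V 5;;
     11 ::= C 2 * V 18 * V 0 + V 19 / V 0;;
     12 ::= (C 2 * V 18 + C 1) * V 0 + V 19 mod V 0;;
     13 ::= V 7 + (C 0 <? V 18 mod C 4) * G 2 (V 19))
    (18 ::= V 17 - C 5 * V 5;;
     19 ::= V 18 / (C 6 * V 0);;
     18 ::= V 18 mod (C 6 * V 0);;
     Cond (V 18 <? C 4 * V 0)
       (12 ::= V 18 mod V 0;;
        13 ::= V 7 + V 6 * (V 0 - C 1 - V 19)
               + (V 18 / V 0 mod C 2 =? C 0) * G 2 (V 19 * V 0 + V 12);;
        11 ::= (C 3 + V 18 / V 0) * V 0 + V 12;;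
        12 ::= (C 10 + V 18 / V 0 / C 2) * V 0 + (V 12 + V 19) mod V 0)
       (18 ::= V 18 - C 4 * V 0;;
        11 ::= (C 1 + C 7 * (V 18 mod C 2)) * V 0 + V 19;;
        12 ::= (C 2 + C 5 * (V 18 mod C 2)) * V 0 + V 18 / C 2;;
        13 ::= V 7 + V 6 * (V 5 - C 1 - (V 19 * V 0 + V 18 / C 2)))).

Definition next_round : stmt := 9 ::= V 9 + C 1.

Definition stmt_low : stmt -> bool :=
  fix go c :=
    match c with
    | Asg x _ => x <? 20
    | Put a _ _ => a <? 10
    | Then c1 c2 | Cond _ c1 c2 => (go c1 && go c2)%bool
    | Nop => true
    end.

Lemma run_simulates c st s :
  stmt_low c = true -> simulates st s -> simulates st (run c s).
Proof.
  revert s. induction c as [x e|a i e|c1 IH1 c2 IH2|e c1 IH1 c2 IH2|];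
    intros s h hs; cbn in h |- *; auto.
  - apply Nat.ltb_lt in h. destruct hs as [hr hm]; split; auto.
    intros y. unfold set_reg; cbn [reg].
    destruct (Nat.eqb_spec (40 + y) x); auto; lia.
  - apply Nat.ltb_lt in h. destruct hs as [hr hm]; split; auto.
    intros b j. unfold set_mem; cbn [mem].
    destruct (Nat.eqb_spec (10 + b) a); cbn [andb]; auto; lia.
  - apply Bool.andb_true_iff in h as [h1 h2]. auto.
  - apply Bool.andb_true_iff in h as [h1 h2]. destruct (ev s e =? 0); auto.
Qed.

(** [B] acts as infinity. In a simple graph it also stands on the diagonal, so tuples with repeated
    vertices are ruled out by their weight. *)
Definition completed (g : wgraph) (B : nat) (i j : nat) : nat :=
  match g i j with Some w => w | None => B end.

Local Ltac simp :=
  cbn -[Nat.mul Nat.div Nat.modulo Nat.sub Nat.add Nat.ltb Nat.pow].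

(** * Computing the edges without overflow *)

Section Programs.

Context (W n B L M : nat) (g : wgraph).
Context (n_pos : 0 < n) (B_pos : 1 <= B) (L_def : L = 5 * B + 1)
        (M_def : M = 7 * (n * n) * L) (M_bound : 100 * M < 2 ^ W)
        (g_le : forall i j w, g i j = Some w -> w <= B).

Local Notation wt := (completed g B).

Definition ready (s : state) : Prop :=
  (reg s 0 = n /\ reg s 5 = n * n /\ reg s 6 = L /\ reg s 7 = M /\ reg s 8 = B) /\
  forall p, p < n * n -> mem s 2 p = wt (p / n) (p mod n).

Lemma M_large : n <= n * n /\ 42 * (n * n) <= M /\ B < L /\ 7 * L <= M.
Proof.
  assert (1 <= n * n) as h by nia. assert (n <= n * n) by nia.
  assert (42 * (n * n) <= M) by (rewrite M_def; clear M_def; nia).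
  assert (7 * L <= M) by (rewrite M_def; clear M_def; nia).
  lia.
Qed.

Lemma L_mul x : x <= 7 * (n * n) -> L * x <= M.
Proof. intros h. rewrite M_def, Nat.mul_comm. now apply Nat.mul_le_mono_r. Qed.

Lemma wt_le i j : wt i j <= B.
Proof. unfold completed. destruct (g i j) eqn:E; eauto. Qed.

Lemma W_pos : 0 < W.
Proof.
  pose proof M_large. destruct W; [cbn in M_bound; nia|lia].
Qed.

Definition same_except (xs : list nat) (s s' : state) : Prop :=
  forall x, ~ In x xs -> reg s' x = reg s x.

(** [gen_edge] evaluates the formulas of [decode] and of the ends and weights literally; the real
    content is that [M_bound] keeps every intermediate value below [2 ^ W]. *)
Lemma gen_edge_spec s k :
  ready s -> reg s 17 = k -> k < 11 * (n * n) ->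
  stmt_ok W gen_edge s /\
  reg (run gen_edge s) 11 = ledge_src n (decode n k) /\
  reg (run gen_edge s) 12 = ledge_dst n (decode n k) /\
  reg (run gen_edge s) 13 = ledge_len n L M wt (decode n k) /\
  same_except [11; 12; 13; 18; 19] s (run gen_edge s) /\
  mem (run gen_edge s) = mem s.
Proof.
  intros [(r0 & r5 & r6 & r7 & r8) hw] r17 hk.
  assert (stmt_ok W gen_edge s /\
    reg (run gen_edge s) 11 = ledge_src n (decode n k) /\
    reg (run gen_edge s) 12 = ledge_dst n (decode n k) /\
    reg (run gen_edge s) 13 = ledge_len n L M wt (decode n k)) as H.
  { pose proof M_large as (m1 & m2 & m3 & m4).
    unfold gen_edge, decode. simp. rewrite r17, r5.
    destruct (Nat.ltb_spec k (5 * (n * n))) as [h|h]; simp.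
    - rewrite !r0, !r7.
      destruct (divmod_lt (n * n) 5 k h) as [h1 h2].
      set (f := k / (n * n)) in *. set (p := k mod (n * n)) in *.
      destruct (divmod_lt n n p h2) as [h3 h4].
      rewrite (hw p h2). unfold node.
      set (i := p / n) in *. set (j := p mod n) in *. pose proof (wt_le i j).
      assert (f mod 4 < 4) by (apply Nat.mod_upper_bound; lia).
      clearbody f p i j.
      assert (f * n <= 4 * n) by nia.
      destruct (0 <? f mod 4); repeat split; try lia.
    - rewrite !r0.
      destruct (divmod_lt (6 * n) n (k - 5 * (n * n))) as [h1 h2]; [lia|].
      set (r := (k - 5 * (n * n)) mod (6 * n)) in *.
      set (a := (k - 5 * (n * n)) / (6 * n)) in *.
      clearbody r a.
      destruct (Nat.ltb_spec r (4 * n)) as [h3|h3]; simp; rewrite ?r0, ?r5, ?r6, ?r7.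
      + destruct (divmod_lt n 4 r h3) as [h4 h5].
        set (q := r / n) in *. set (c := r mod n) in *.
        pose proof (pair_lt n a c h1 h5) as h6.
        rewrite (hw _ h6). destruct (divmod_eq n a c h5) as [-> ->].
        unfold node. pose proof (wt_le a c).
        assert (q / 2 < 2) by (apply Nat.Div0.div_lt_upper_bound; lia).
        assert ((c + a) mod n < n) by (apply Nat.mod_upper_bound; lia).
        pose proof (L_mul (n - 1 - a) ltac:(lia)).
        set (x := L * (n - 1 - a)) in *. set (y := (c + a) mod n) in *.
        assert (q mod 2 < 2) by (apply Nat.mod_upper_bound; lia).
        clearbody q c x y.
        assert ((3 + q) * n <= 6 * n) by nia.
        assert ((10 + q / 2) * n <= 11 * n) by nia.
        destruct (q mod 2 =? 0); repeat split; try lia.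
      + assert ((r - 4 * n) / 2 < n) by (apply Nat.Div0.div_lt_upper_bound; lia).
        assert ((r - 4 * n) mod 2 < 2) by (apply Nat.mod_upper_bound; lia).
        set (b := (r - 4 * n) / 2) in *. set (h' := (r - 4 * n) mod 2) in *.
        pose proof (pair_lt n a b h1 ltac:(auto)).
        pose proof (L_mul (n * n - 1 - (a * n + b)) ltac:(lia)).
        set (x := L * (n * n - 1 - (a * n + b))) in *. unfold node.
        clearbody b h' x.
        assert ((1 + 7 * h') * n <= 8 * n) by nia.
        assert ((2 + 5 * h') * n <= 7 * n) by nia.
        repeat split; try lia. }
  destruct H as (H1 & H2 & H3 & H4).
  refine (conj H1 (conj H2 (conj H3 (conj H4 (conj _ _))))).
  - intros x hx. unfold gen_edge. simp.
    assert (x <> 11 /\ x <> 12 /\ x <> 13 /\ x <> 18 /\ x <> 19) as (x1 & x2 & x3 & x4 & x5)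
      by (cbn in hx; intuition).
    repeat match goal with |- context [if ?c then _ else _] =>
      match c with context [x] => fail 1 | _ => destruct c end end;
    unfold set_reg; cbn [reg];
    apply Nat.eqb_neq in x1, x2, x3, x4, x5; now rewrite ?x1, ?x2, ?x3, ?x4, ?x5.
  - unfold gen_edge. cbn [run].
    repeat match goal with |- context [if ?c then _ else _] => destruct c end; reflexivity.
Qed.
Lemma ready_same s s' :
  ready s -> (forall x, x = 0 \/ 5 <= x <= 8 -> reg s' x = reg s x) ->
  (forall i, mem s' 2 i = mem s 2 i) -> ready s'.
Proof.
  intros [h hw] hr hm. split.
  - rewrite !hr by lia. exact h.
  - intros p hp. rewrite hm. auto.
Qed.

Local Ltac ready_regs :=
  let x := fresh in let hx := fresh in intros x hx;
  assert (x = 0 \/ x = 5 \/ x = 6 \/ x = 7 \/ x = 8) as [-> | [-> | [-> | [-> | ->]]]]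
    by lia; reflexivity.

Lemma simulates_args2 st s x y :
  simulates st s ->
  simulates (load_regs st [x; y]) (set_reg (set_reg s 40 x) 41 y).
Proof.
  intros [hr hm]; split; auto.
  intros [|[|z]]; [reflexivity|reflexivity|].
  cbn. destruct z; apply (hr (S (S _))).
Qed.

Lemma simulates_args3 st s x y z :
  simulates st s ->
  simulates (load_regs st [x; y; z])
    (set_reg (set_reg (set_reg s 40 x) 41 y) 42 z).
Proof.
  intros [hr hm]; split; auto.
  intros [|[|[|u]]]; [reflexivity|reflexivity|reflexivity|].
  cbn. destruct u; apply (hr (S (S (S _)))).
Qed.

(** * Running the incremental algorithm *)

Local Notation graph_after := (stage n L M wt).
Local Notation src k := (ledge_src n (decode n k)).
Local Notation dst k := (ledge_dst n (decode n k)).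
Local Notation len k := (ledge_len n L M wt (decode n k)).
Local Notation rounds := (11 * (n * n)).

Lemma ends_lt k : k < rounds -> src k < 12 * n /\ dst k < 12 * n /\ src k <> dst k.
Proof. intros h. apply ends_bound, decode_ok, h. Qed.

Lemma len_le k : k < rounds -> len k <= 3 * M.
Proof.
  intros _. pose proof M_large. destruct (decode n k) as [f i j|q a c|h a b];
    cbn [ledge_len].
  - pose proof (wt_le i j). destruct (0 <? f mod 4); lia.
  - pose proof (wt_le a c). pose proof (L_mul (n - 1 - a) ltac:(lia)).
    destruct (q mod 2 =? 0); lia.
  - pose proof (L_mul (n * n - 1 - (a * n + b)) ltac:(lia)). lia.
Qed.

(** Array 3 is filled after every update, also when the target is unreachable and the stored word is
    arbitrary; hence the proviso. It is indexed by the number of edges present, which serves both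
    directions of time. *)
Definition answered (lo hi : nat) (s : state) : Prop :=
  forall q, lo <= q < hi -> (exists l, walk (graph_after q) 0 (9 * n) l) ->
    is_dist (graph_after q) 0 (9 * n) (mem s 3 q).

Lemma reports_dist h st :
  reports h 0 (9 * n) st -> (exists l, walk h 0 (9 * n) l) ->
  is_dist h 0 (9 * n) (reg st 1).
Proof. intros [[_ H]|[_ H]] hw; [exact H|contradiction]. Qed.

(** Source and target are the nodes with index 0 in the layers 0 and 9; registers 40, 41, 42 are the
    input registers of the embedded algorithm. *)
Definition load_problem : stmt :=
  40 ::= C 12 * V 0;; 41 ::= C 0;; 42 ::= C 9 * V 0.

Definition start_rounds : stmt := 9 ::= C 0;; 10 ::= C 11 * V 5.

Definition gen_round (e : expr) : stmt := 17 ::= e;; gen_edge.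

Definition inc_before : stmt :=
  gen_round (V 9);; 40 ::= V 11;; 41 ::= V 12;; 42 ::= V 13.

(** Round [k] inserts edge [k], so the reported graph has [k + 1] edges. Register 41 is register 1
    of the algorithm, its reported distance. *)
Definition inc_after : stmt := Put 3 (V 9 + C 1) (V 41);; next_round.

Definition inc_driver (A : dyn_alg) : com :=
  Seq (compile load_problem) (Seq (shift (preprocess A)) (Seq (compile start_rounds)
    (loop (Seq (compile inc_before) (Seq (shift (process A)) (compile inc_after)))))).

Lemma load_problem_runs st s :
  ready s -> simulates st s ->
  exists s', runs W s (compile load_problem) (stmt_cost load_problem) s' /\
    ready s' /\ simulates (load_regs st [12 * n; 0; 9 * n]) s'.
Proof.
  intros hs hst. pose proof W_pos. pose proof M_large.
  assert (reg s 0 = n) as r0 by apply hs.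
  exists (run load_problem s). split; [|split].
  - apply runs_compile; auto. unfold load_problem. simp. rewrite r0. lia.
  - eapply ready_same; [exact hs|ready_regs|reflexivity].
  - rewrite <- r0. apply (simulates_args3 st s _ _ _ hst).
Qed.

Lemma start_rounds_runs st s :
  ready s -> simulates st s ->
  exists s', runs W s (compile start_rounds) (stmt_cost start_rounds) s' /\
    ready s' /\ simulates st s' /\ reg s' 9 = 0 /\ reg s' 10 = rounds.
Proof.
  intros hs hst. pose proof W_pos. pose proof M_large.
  assert (reg s 5 = n * n) as r5 by apply hs.
  exists (run start_rounds s). split; [|split; [|split; [|split]]].
  - apply runs_compile; auto. unfold start_rounds. simp. rewrite r5. lia.
  - eapply ready_same; [exact hs|ready_regs|reflexivity].
  - now apply run_simulates.
  - reflexivity.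
  - cbn. now rewrite r5.
Qed.

Lemma gen_round_spec st s e k :
  ready s -> simulates st s -> expr_ok W s e -> ev s e = k -> k < rounds ->
  let s' := run (gen_round e) s in
  stmt_ok W (gen_round e) s /\ ready s' /\ simulates st s' /\
  (reg s' 11 = src k /\ reg s' 12 = dst k /\ reg s' 13 = len k) /\
  same_except [11; 12; 13; 17; 18; 19] s s' /\ reg s' 17 = k /\ mem s' = mem s.
Proof.
  intros hs hst hok he hk. pose proof M_large as (m1 & m2 & _).
  cbn zeta. unfold gen_round; cbn [stmt_ok run]. rewrite he.
  set (s0 := set_reg s 17 k).
  assert (ready s0) as hs0 by (eapply ready_same; [exact hs|ready_regs|reflexivity]).
  assert (simulates st s0) as hst0.
  { replace s0 with (run (17 ::= C k) s) by reflexivity. now apply run_simulates. }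
  destruct (gen_edge_spec s0 k hs0 eq_refl hk) as (ok & e1 & e2 & e3 & same & hm).
  assert (simulates st (run gen_edge s0)) as hst1 by now apply run_simulates.
  refine (conj (conj (conj hok _) ok) (conj _ (conj hst1 (conj (conj e1 (conj e2 e3)) _)))).
  - lia.
  - eapply ready_same; [exact hs0| |intros; now rewrite hm].
    intros x hx. apply same. cbn. lia.
  - split; [|split].
    + intros x hx. rewrite same by (intros hin; apply hx; cbn in *; tauto).
      unfold s0; cbn [set_reg reg].
      destruct (Nat.eqb_spec x 17); auto. subst; cbn in hx; lia.
    + rewrite same; [reflexivity|cbn; lia].
    + rewrite hm; reflexivity.
Qed.

Lemma inc_before_runs st s k :
  ready s -> simulates st s -> reg s 9 = k -> k < rounds ->
  exists s', runs W s (compile inc_before) (stmt_cost inc_before) s' /\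
    ready s' /\ simulates (load_regs st [src k; dst k; len k]) s' /\
    reg s' 9 = k /\ reg s' 10 = reg s 10 /\ mem s' 3 = mem s 3.
Proof.
  intros hs hst r9 hk. pose proof W_pos. pose proof M_large as (m1 & m2 & _).
  pose proof (ends_lt k hk) as (k1 & k2 & _). pose proof (len_le k hk) as k3.
  destruct (gen_round_spec st s (V 9) k hs hst Logic.I r9 hk)
    as (ok & hr & hsim & (e1 & e2 & e3) & same & _ & hm).
  exists (run inc_before s). unfold inc_before. split.
  { apply runs_compile; auto. cbn [stmt_ok run].
    set (s1 := run (gen_round (V 9)) s) in *. clearbody s1.
    cbn [ev expr_ok set_reg reg Nat.eqb]. rewrite e1, e2, e3.
    refine (conj ok _); repeat split; lia. }
  cbn [run]. set (s1 := run (gen_round (V 9)) s) in *. clearbody s1.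
  cbn [ev reg set_reg Nat.eqb]. rewrite e1, e2, e3. split; [|split; [|split; [|split]]].
  - eapply ready_same; [exact hr|ready_regs|reflexivity].
  - now apply simulates_args3.
  - cbn. rewrite same by (cbn; lia). exact r9.
  - cbn. rewrite same by (cbn; lia). reflexivity.
  - cbn [mem set_reg]. now rewrite hm.
Qed.

Definition insertion (k : nat) : update := Insert (src k) (dst k) (len k).

Lemma inc_driver_runs A st0 t0 t1 s :
  ready s -> simulates zero_state s ->
  exec W (preprocess A) (load_regs zero_state [12 * n; 0; 9 * n]) t0 st0 ->
  serves W (process A) 0 (9 * n) empty_graph st0 (map insertion (seq 0 rounds)) t1 ->
  exists s' t, runs W s (inc_driver A) t s' /\ ready s' /\ answered 1 rounds s' /\
    t <= t0 + t1 + (stmt_cost inc_before + stmt_cost inc_after + 2) * rounds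
         + (stmt_cost load_problem + stmt_cost start_rounds + 2).
Proof.
  intros hs hst hpre hserve. pose proof W_pos as hW. pose proof M_large as (m1 & m2 & _).
  destruct (load_problem_runs zero_state s hs hst) as (s1 & x1 & hs1 & hst1).
  destruct (runs_shift _ _ _ _ _ _ hpre hst1) as (s2 & x2 & hst2 & [lr lm]).
  assert (ready s2) as hs2
    by (eapply ready_same; [exact hs1|intros; apply lr; lia|intros; apply lm; lia]).
  destruct (start_rounds_runs st0 s2 hs2 hst2) as (s3 & x3 & hs3 & hst3 & z9 & z10).
  set (cb := stmt_cost inc_before + stmt_cost inc_after).
  (* [u] is the time that the algorithm will spend on the updates to come. Bounding [t + u] charges
     its total time [t1] once, whatever single updates cost. *)
  set (I := fun k t s => ready s /\ reg s 9 = k /\ reg s 10 = rounds /\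
    answered 1 (S k) s /\
    exists st u, simulates st s /\ t + u <= t1 + cb * k /\
      serves W (process A) 0 (9 * n) (graph_after k) st
        (map insertion (seq k (rounds - k))) u).
  destruct (runs_loop W I rounds
    (Seq (compile inc_before) (Seq (shift (process A)) (compile inc_after))) s3)
    as (t & s4 & x4 & h4 & _ & _ & h4' & st4 & u4 & _ & hu & _); auto.
  - intros k t s4 _ (_ & h1 & h2 & _). auto.
  - intros k t s4 hk (hr & h9 & h10 & hans & st & u & hsim & hu & hv).
    replace (rounds - k) with (S (rounds - S k)) in hv by lia. cbn [seq map] in hv.
    inversion hv as [|? ? ? ? u1 st1 u2 hex hrep hrest]; subst.
    destruct (inc_before_runs st s4 (reg s4 9) hr hsim eq_refl hk)
      as (s5 & y1 & hr5 & hsim5 & h59 & h510 & hm5).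
    destruct (runs_shift _ _ _ _ _ _ hex hsim5) as (s6 & y2 & hsim6 & [lr6 lm6]).
    set (k := reg s4 9) in *. clearbody k.
    assert (reg s6 9 = k) as h69 by (rewrite lr6; lia).
    assert (ready s6) as hr6
      by (eapply ready_same; [exact hr5|intros; apply lr6; lia|intros; apply lm6; lia]).
    exists (stmt_cost inc_before + (u1 + stmt_cost inc_after)), (run inc_after s6).
    split; [|split; [|split; [|split; [|split]]]].
    + eapply runs_seq; [exact y1|]. eapply runs_seq; [exact y2|].
      apply runs_compile; auto. unfold inc_after, next_round. simp. rewrite h69. lia.
    + eapply ready_same; [exact hr6|ready_regs|reflexivity].
    + cbn. rewrite h69. lia.
    + cbn. rewrite lr6, h510 by lia. exact h10.
    + intros q hq hwalk. cbn. rewrite h69, Nat.add_1_r.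
      destruct (Nat.eqb_spec q (S k)) as [->|hne]; cbn [andb].
      * change (reg s6 41) with (reg s6 (40 + 1)). rewrite (proj1 hsim6 1).
        apply reports_dist; auto.
      * rewrite lm6, hm5 by lia. apply hans; auto. lia.
    + exists st1, u2. split; [|split].
      * apply run_simulates; auto.
      * unfold cb in *. lia.
      * exact hrest.
  - split; [exact hs3|split; [exact z9|split; [exact z10|split]]].
    + intros q hq; lia.
    + exists st0, t1. split; [auto|split; [lia|]]. rewrite Nat.sub_0_r. exact hserve.
  - exists s4, (stmt_cost load_problem +
      (t0 + (stmt_cost start_rounds + (t + 2 * rounds + 2)))).
    split; [|split; [auto|split]].
    + eapply runs_seq; [exact x1|]. eapply runs_seq; [exact x2|].
      eapply runs_seq; [exact x3|exact x4].
    + intros q hq. apply h4'. lia.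
    + unfold cb in *. lia.
Qed.

(** * Running the decremental algorithm *)

Definition deletion (k : nat) : update := Delete (src k) (dst k).

Fixpoint deletions (k : nat) : list update :=
  match k with 0 => [] | S k => deletion k :: deletions k end.

(** The pair was empty before its insertion by [stage_fresh], so deleting the edge restores exactly
    the previous graph. *)
Lemma deletion_stage k :
  k < rounds -> apply_update (graph_after (S k)) (deletion k) = graph_after k.
Proof.
  intros hk. extensionality x; extensionality y.
  cbn [apply_update deletion stage].
  pose proof (stage_fresh n L M wt k hk) as hf.
  destruct (set_edge_eq (set_edge (graph_after k) (src k) (dst k) (Some (len k)))
              (src k) (dst k) None x y) as [[-> H]|[-> H]].
  - destruct (stage_is_graph n L M wt k ltac:(lia)) as (_ & hsym & _).
    destruct H as [[-> ->]|[-> ->]]; [|rewrite hsym]; auto.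
  - destruct (set_edge_eq (graph_after k) (src k) (dst k) (Some (len k)) x y)
      as [[_ ?]|[-> _]]; tauto.
Qed.

(** Arrays 10 and 11 are arrays 0 and 1 of the embedded algorithm: its initial graph is written
    directly into its memory, each edge in both orders. *)
Definition store_edge : stmt :=
  gen_round (V 9);;
  18 ::= V 11 * (C 12 * V 0) + V 12;;
  19 ::= V 12 * (C 12 * V 0) + V 11;;
  Put 10 (V 18) (C 1);; Put 10 (V 19) (C 1);;
  Put 11 (V 18) (V 13);; Put 11 (V 19) (V 13);;
  next_round.

Definition dec_before : stmt :=
  gen_round (V 10 - C 1 - V 9);; 40 ::= V 11;; 41 ::= V 12.

Definition dec_after : stmt := Put 3 (V 17) (V 41);; next_round.

Definition dec_driver (A : dyn_alg) : com :=
  Seq (compile start_rounds) (Seq (loop (compile store_edge))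
    (Seq (compile load_problem) (Seq (shift (preprocess A)) (Seq (compile start_rounds)
      (loop (Seq (compile dec_before) (Seq (shift (process A)) (compile dec_after)))))))).

Lemma graph_state_set_edge N h u v w a i :
  u < N -> v < N ->
  mem (graph_state N (set_edge h u v (Some w))) a i =
  if ((i =? u * N + v) || (i =? v * N + u))%bool then
    match a with 0 => 1 | 1 => w | _ => 0 end
  else mem (graph_state N h) a i.
Proof.
  intros hu hv. cbn [mem graph_state].
  destruct (divmod_eq N u v hv) as [q1 q2], (divmod_eq N v u hu) as [q3 q4].
  destruct (set_edge_eq h u v (Some w) (i / N) (i mod N)) as [[-> H]|[-> H]].
  - replace ((i =? u * N + v) || (i =? v * N + u))%bool with true.
    { destruct a as [|[|a]]; reflexivity. }
    symmetry. apply Bool.orb_true_iff. rewrite !Nat.eqb_eq.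
    pose proof (Nat.div_mod_eq i N) as e.
    destruct H as [[H1 H2]|[H1 H2]]; rewrite H1, H2 in e; lia.
  - replace ((i =? u * N + v) || (i =? v * N + u))%bool with false; auto.
    symmetry. apply Bool.orb_false_iff. rewrite !Nat.eqb_neq.
    split; intros ->; apply H; auto.
Qed.

Lemma store_edge_runs s k :
  ready s -> simulates (graph_state (12 * n) (graph_after k)) s -> reg s 9 = k -> k < rounds ->
  exists s', runs W s (compile store_edge) (stmt_cost store_edge) s' /\
    ready s' /\ simulates (graph_state (12 * n) (graph_after (S k))) s' /\
    reg s' 9 = S k /\ reg s' 10 = reg s 10.
Proof.
  intros hs hst r9 hk. pose proof W_pos. pose proof M_large as (m1 & m2 & _).
  pose proof (ends_lt k hk) as (k1 & k2 & _).
  assert (src k * (12 * n) <= 144 * (n * n)) by nia.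
  assert (dst k * (12 * n) <= 144 * (n * n)) by nia.
  destruct (gen_round_spec _ s (V 9) k hs hst Logic.I r9 hk)
    as (ok & hr & hsim & (e1 & e2 & e3) & same & _ & hm).
  assert (reg (run (gen_round (V 9)) s) 0 = n) as e0 by apply hr.
  assert (reg (run (gen_round (V 9)) s) 9 = k) as e9
    by (rewrite same; [exact r9|cbn; lia]).
  exists (run store_edge s). unfold store_edge, next_round. split.
  { apply runs_compile; auto. cbn [stmt_ok run].
    set (s1 := run (gen_round (V 9)) s) in *. clearbody s1.
    cbn [ev expr_ok set_reg set_mem nat_binop binop_ok reg mem Nat.eqb].
    rewrite e0, e1, e2, e9. refine (conj ok _); repeat split; lia. }
  cbn [run]. set (s1 := run (gen_round (V 9)) s) in *. clearbody s1.
  split; [|split; [|split]].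
  - eapply ready_same; [exact hr|ready_regs|reflexivity].
  - destruct hsim as [hsr hsm]. split; [exact hsr|].
    intros a i. cbn [stage]. rewrite graph_state_set_edge by lia.
    cbn [set_mem set_reg mem reg ev nat_binop Nat.eqb].
    rewrite e0, e1, e2, e3.
    destruct a as [|[|a]].
    + rewrite <- hsm. cbn [Nat.add Nat.eqb andb].
      destruct (i =? src k * (12 * n) + dst k), (i =? dst k * (12 * n) + src k); reflexivity.
    + rewrite <- hsm. cbn [Nat.add Nat.eqb andb].
      destruct (i =? src k * (12 * n) + dst k), (i =? dst k * (12 * n) + src k); reflexivity.
    + transitivity (mem s1 (10 + S (S a)) i); [reflexivity|].
      rewrite hsm. cbn [graph_state mem].
      destruct ((i =? src k * (12 * n) + dst k) || (i =? dst k * (12 * n) + src k))%bool;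
        reflexivity.
  - cbn. rewrite e9. lia.
  - cbn. rewrite same by (cbn; lia). reflexivity.
Qed.

Lemma dec_before_runs st s k :
  ready s -> simulates st s -> reg s 10 = rounds -> reg s 9 + S k = rounds ->
  exists s', runs W s (compile dec_before) (stmt_cost dec_before) s' /\
    ready s' /\ simulates (load_regs st [src k; dst k]) s' /\
    reg s' 9 = reg s 9 /\ reg s' 10 = rounds /\ reg s' 17 = k /\ mem s' 3 = mem s 3.
Proof.
  intros hs hst r10 r9. pose proof W_pos. pose proof M_large as (m1 & m2 & _).
  assert (k < rounds) as hk by lia.
  pose proof (ends_lt k hk) as (k1 & k2 & _).
  destruct (gen_round_spec st s (V 10 - C 1 - V 9)%expr k hs hst)
    as (ok & hr & hsim & (e1 & e2 & e3) & same & e17 & hm); auto.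
  { cbn [expr_ok binop_ok nat_binop ev]. rewrite r10. repeat split; lia. }
  { cbn [ev nat_binop]. lia. }
  exists (run dec_before s). unfold dec_before. split.
  { apply runs_compile; auto. cbn [stmt_ok run].
    set (s1 := run (gen_round _) s) in *. clearbody s1.
    cbn [ev expr_ok set_reg reg Nat.eqb]. rewrite e1, e2.
    refine (conj ok _); repeat split; lia. }
  cbn [run]. set (s1 := run (gen_round _) s) in *. clearbody s1.
  cbn [ev reg set_reg Nat.eqb]. rewrite e1, e2.
  split; [|split; [|split; [|split; [|split]]]].
  - eapply ready_same; [exact hr|ready_regs|reflexivity].
  - now apply simulates_args2.
  - cbn. apply same. cbn; lia.
  - cbn. rewrite same by (cbn; lia). exact r10.
  - cbn. exact e17.
  - cbn [mem set_reg]. now rewrite hm.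
Qed.

Lemma dec_driver_runs A st0 t0 t1 s :
  ready s -> simulates zero_state s ->
  exec W (preprocess A)
    (load_regs (graph_state (12 * n) (graph_after rounds)) [12 * n; 0; 9 * n]) t0 st0 ->
  serves W (process A) 0 (9 * n) (graph_after rounds) st0 (deletions rounds) t1 ->
  exists s' t, runs W s (dec_driver A) t s' /\ ready s' /\ answered 1 rounds s' /\
    t <= t0 + t1
      + (stmt_cost store_edge + stmt_cost dec_before + stmt_cost dec_after + 4) * rounds
      + (stmt_cost load_problem + 2 * stmt_cost start_rounds + 4).
Proof.
  intros hs hst hpre hserve. pose proof W_pos as hW. pose proof M_large as (m1 & m2 & _).
  destruct (start_rounds_runs _ s hs hst) as (s1 & x1 & hs1 & hst1 & y9 & y10).
  set (J := fun k t s => ready s /\ reg s 9 = k /\ reg s 10 = rounds /\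
    simulates (graph_state (12 * n) (graph_after k)) s /\ t <= stmt_cost store_edge * k).
  destruct (runs_loop W J rounds (compile store_edge) s1)
    as (tj & s2 & x2 & hs2 & _ & _ & hst2 & htj); auto.
  - intros k t s2 _ (_ & h1 & h2 & _). auto.
  - intros k t s2 hk (hr & h9 & h10 & hsim & ht).
    destruct (store_edge_runs s2 k hr hsim h9 hk) as (s3 & z & hr3 & hsim3 & h39 & h310).
    exists (stmt_cost store_edge), s3. split; [exact z|].
    refine (conj hr3 (conj h39 (conj _ (conj hsim3 _)))); [now rewrite h310|lia].
  - refine (conj hs1 (conj y9 (conj y10 (conj _ _)))); [|lia].
    destruct hst1 as [hr hm]. split; [exact hr|].
    intros a i. rewrite hm. cbn. destruct a as [|[|a]]; reflexivity.
  - destruct (load_problem_runs _ s2 hs2 hst2) as (s3 & x3 & hs3 & hst3).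
    destruct (runs_shift _ _ _ _ _ _ hpre hst3) as (s4 & x4 & hst4 & [lr lm]).
    assert (ready s4) as hs4
      by (eapply ready_same; [exact hs3|intros; apply lr; lia|intros; apply lm; lia]).
    destruct (start_rounds_runs st0 s4 hs4 hst4) as (s5 & x5 & hs5 & hst5 & z9 & z10).
    set (cb := stmt_cost dec_before + stmt_cost dec_after).
    (* Array 3 is filled downwards from cell [rounds - 1]; the initial graph with all edges is never
       reported. As before, [u] is the time left for the remaining updates. *)
    set (I := fun k t s => ready s /\ reg s 9 = k /\ reg s 10 = rounds /\
      answered (rounds - k) rounds s /\
      exists st u, simulates st s /\ t + u <= t1 + cb * k /\
        serves W (process A) 0 (9 * n) (graph_after (rounds - k)) st
          (deletions (rounds - k)) u).
    destruct (runs_loop W I rounds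
      (Seq (compile dec_before) (Seq (shift (process A)) (compile dec_after))) s5)
      as (t & s6 & x6 & h6 & _ & _ & h6' & st6 & u6 & _ & hu & _); auto.
    + intros k t s6 _ (_ & h1 & h2 & _). auto.
    + intros k t s6 hk (hr & h9 & h10 & hans & st & u & hsim & hu & hv).
      remember (rounds - S k) as m eqn:hm.
      replace (rounds - k) with (S m) in * by lia. cbn [deletions] in hv.
      inversion hv as [|? ? ? ? u1 st1 u2 hex hrep hrest]; subst k.
      rewrite deletion_stage in hrep, hrest by lia.
      destruct (dec_before_runs st s6 m hr hsim h10 ltac:(lia))
        as (s7 & y1 & hr7 & hsim7 & h79 & h710 & h717 & hm7).
      destruct (runs_shift _ _ _ _ _ _ hex hsim7) as (s8 & y2 & hsim8 & [lr8 lm8]).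
      assert (reg s8 9 = reg s6 9) as h89 by (rewrite lr8; lia).
      assert (reg s8 17 = m) as h817 by (rewrite lr8; lia).
      assert (ready s8) as hr8
        by (eapply ready_same; [exact hr7|intros; apply lr8; lia|intros; apply lm8; lia]).
      exists (stmt_cost dec_before + (u1 + stmt_cost dec_after)), (run dec_after s8).
      split; [|split; [|split; [|split; [|split]]]].
      * eapply runs_seq; [exact y1|]. eapply runs_seq; [exact y2|].
        apply runs_compile; auto. unfold dec_after, next_round. simp. rewrite h89. lia.
      * eapply ready_same; [exact hr8|ready_regs|reflexivity].
      * cbn. rewrite h89. lia.
      * cbn. rewrite lr8, h710 by lia. reflexivity.
      * rewrite <- hm. intros q hq hwalk. cbn. rewrite h817.
        destruct (Nat.eqb_spec q m) as [->|hne]; cbn [andb].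
        -- change (reg s8 41) with (reg s8 (40 + 1)). rewrite (proj1 hsim8 1).
           apply reports_dist; auto.
        -- rewrite lm8, hm7 by lia. apply hans; auto. lia.
      * rewrite <- hm. exists st1, u2. split; [|split].
        -- apply run_simulates; auto.
        -- unfold cb in *. lia.
        -- exact hrest.
    + split; [exact hs5|split; [exact z9|split; [exact z10|split]]].
      * intros q hq; lia.
      * exists st0, t1. split; [auto|split; [lia|]]. rewrite Nat.sub_0_r. exact hserve.
    + exists s6, (stmt_cost start_rounds + ((tj + 2 * rounds + 2) + (stmt_cost load_problem
        + (t0 + (stmt_cost start_rounds + (t + 2 * rounds + 2)))))).
      split; [|split; [auto|split]].
      * eapply runs_seq; [exact x1|]. eapply runs_seq; [exact x2|].
        eapply runs_seq; [exact x3|]. eapply runs_seq; [exact x4|].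
        eapply runs_seq; [exact x5|exact x6].
      * intros q hq. apply h6'. lia.
      * unfold cb in *. lia.
Qed.

(** * Searching for a clique of minimum weight *)

Definition keep_min : stmt :=
  Cond (V 13 <? V 14) (14 ::= V 13;; 15 ::= V 9) Nop;; next_round.

(** The minimum starts at [B], meaning that no clique has been found. The index is significant only
    once the minimum is smaller, but it is always the code of a pair. *)
Definition least (f : nat -> nat) (k : nat) (s : state) : Prop :=
  (forall q, q < k -> reg s 14 <= f q) /\ reg s 14 <= B /\
  (reg s 14 < B -> reg s 15 < k /\ f (reg s 15) = reg s 14) /\ reg s 15 < n * n.

Lemma keep_min_spec f k s :
  least f k s -> reg s 9 = k -> reg s 13 = f k -> k < n * n -> f k < 2 ^ W ->
  stmt_ok W keep_min s /\ least f (S k) (run keep_min s) /\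
  reg (run keep_min s) 9 = S k /\ same_except [9; 14; 15] s (run keep_min s) /\
  mem (run keep_min s) = mem s.
Proof.
  intros (h1 & h2 & h3 & h4) r9 r13 hk hf. pose proof M_large as (m1 & m2 & _).
  assert (same_except [9; 14; 15] s (run keep_min s) /\
          mem (run keep_min s) = mem s) as hs.
  { unfold keep_min, next_round; cbn [run ev nat_binop]. rewrite r13.
    destruct (f k <? reg s 14); cbn [Nat.eqb]; split; try reflexivity;
      intros x hx; unfold set_reg; cbn [reg];
      destruct (Nat.eqb_spec x 9), (Nat.eqb_spec x 14), (Nat.eqb_spec x 15);
      try reflexivity; subst x; cbn in hx; lia. }
  split; [|split; [|split; [|exact hs]]].
  - unfold keep_min, next_round. simp. rewrite r13.
    destruct (Nat.ltb_spec (f k) (reg s 14)); simp; rewrite ?r9, ?r13; lia.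
  - unfold keep_min, next_round, least. simp. rewrite r13.
    destruct (Nat.ltb_spec (f k) (reg s 14)) as [h|h]; simp; rewrite ?r9, ?r13.
    + repeat split; auto; try lia. intros q hq.
      destruct (Nat.eq_dec q k) as [->|]; [lia|]. specialize (h1 q ltac:(lia)). lia.
    + refine (conj _ (conj h2 (conj _ h4))).
      2: { intros h'. destruct (h3 h'). split; [lia|auto]. }
      intros q hq. destruct (Nat.eq_dec q k) as [->|]; [lia|]. apply h1; lia.
  - unfold keep_min, next_round. simp. rewrite r13.
    destruct (f k <? reg s 14); simp; rewrite r9; lia.
Qed.

Definition start_min (bound : expr) : stmt :=
  9 ::= C 0;; 10 ::= bound;; 14 ::= V 8;; 15 ::= C 0.

Definition phase_value : stmt :=
  18 ::= V 9 / V 0;; 19 ::= V 9 mod V 0;;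
  13 ::= G 3 (C 5 * V 5 + (C 6 * V 0 * V 18 + (C 4 * V 0 + (C 2 * V 19 + C 2))))
         + G 2 (V 9)
         - (C 11 * V 7 +
            V 6 * (C 2 * (V 5 - C 1 - (V 18 * V 0 + V 19)) + C 4 * (V 0 - C 1 - V 18))).

Definition clique_value : stmt :=
  11 ::= V 9 / V 0;; 12 ::= V 9 mod V 0;;
  13 ::= G 2 (V 18 * V 0 + V 19) + G 2 (V 18 * V 0 + V 11) + G 2 (V 18 * V 0 + V 12)
         + G 2 (V 19 * V 0 + V 11) + G 2 (V 19 * V 0 + V 12) + G 2 (V 9).

Definition select_pair : stmt := 18 ::= V 15 / V 0;; 19 ::= V 15 mod V 0.

Definition output : stmt :=
  1 ::= V 18;; 2 ::= V 19;; 3 ::= V 15 / V 0;; 4 ::= V 15 mod V 0;; 0 ::= V 14 <? V 8.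

(** A distance reveals the minimum over [c] and [d] but not where it is attained, so a second scan
    looks for [c] and [d] once the best [(a, b)] is known. The bound [V 5 - C 1] of the first scan
    leaves out the last phase. *)
Definition search : com :=
  Seq (compile (start_min (V 5 - C 1))) (Seq (loop (compile (phase_value;; keep_min)))
    (Seq (compile (select_pair;; start_min (V 5)))
      (Seq (loop (compile (clique_value;; keep_min))) (compile output)))).

Definition total (a b c d : nat) : nat :=
  wt a b + wt a c + wt a d + wt b c + wt b d + wt c d.

(** Removing the part of the distance that depends only on the phase and adding the weight of [ab]
    leaves the minimum of [total a b c d] over all [c] and [d]. *)
Definition pair_value (s : state) (p : nat) : nat :=
  mem s 3 (phase_end n (p / n) (p mod n)) + wt (p / n) (p mod n)
  - base n L M (p / n) (p mod n).

Lemma pair_value_spec s p :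
  is_graph n g -> answered 1 rounds s -> p < n * n - 1 ->
  let a := p / n in let b := p mod n in
  base n L M a b <= mem s 3 (phase_end n a b) + wt a b /\
  (exists c d, c < n /\ d < n /\ pair_value s p = total a b c d) /\
  (forall c d, c < n -> d < n -> pair_value s p <= total a b c d).
Proof.
  intros (_ & hsym & _) hans hp a b.
  destruct (divmod_lt n n p ltac:(lia)) as [ha hb]. fold a b in ha, hb.
  pose proof (Nat.div_mod_eq p n) as hab. fold a b in hab.
  (* Only the phase [(n - 1, n - 1)] ends at [rounds] itself, and [p < n * n - 1] excludes it. *)
  assert (phase_end n a b < rounds) as hend.
  { unfold phase_end. assert (b <= n - 2 \/ a <= n - 2) as [h|h] by nia; nia. }
  assert (1 <= phase_end n a b) as hpos by (unfold phase_end; lia).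
  pose proof M_large as (_ & _ & _ & _).
  destruct (dist_phase n B L M wt a b (mem s 3 (phase_end n a b)) ha hb)
    as [(c & d & hc & hd & e) hle].
  - intros; apply wt_le.
  - lia.
  - lia.
  - apply hans; [lia|]. now apply phase_connected.
  - assert (forall c d, total a b c d = wt a b + rest wt a b c d) as ht.
    { intros c' d'. unfold total, rest.
      replace (wt d' b) with (wt b d') by (unfold completed; now rewrite hsym). lia. }
    unfold pair_value. fold a b. split; [lia|split].
    + exists c, d. rewrite ht. repeat split; auto. lia.
    + intros c' d' hc' hd'. specialize (hle c' d' hc' hd'). rewrite ht. lia.
Qed.

Lemma start_min_spec e K f s :
  ready s -> K <= n * n ->
  (forall s', ready s' -> expr_ok W s' e /\ ev s' e = K) ->
  stmt_ok W (start_min e) s /\ ready (run (start_min e) s) /\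
  reg (run (start_min e) s) 9 = 0 /\ reg (run (start_min e) s) 10 = K /\
  least f 0 (run (start_min e) s).
Proof.
  intros hs hK he. pose proof M_large as (m1 & m2 & m3 & m4).
  assert (ready (set_reg s 9 0)) as hs1
    by (eapply ready_same; [exact hs|ready_regs|reflexivity]).
  destruct (he _ hs1) as [e1 e2].
  assert (reg s 8 = B) as r8 by apply hs.
  unfold start_min. cbn [stmt_ok run]. change (ev s (C 0)) with 0. rewrite e2.
  split; [|split; [|split; [|split]]].
  - refine (conj _ (conj (conj e1 _) _)); [simp; lia|lia|]. simp. rewrite r8. lia.
  - eapply ready_same; [exact hs|ready_regs|reflexivity].
  - reflexivity.
  - reflexivity.
  - unfold least. cbn. rewrite r8. repeat split; lia.
Qed.

Lemma phase_value_spec s :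
  is_graph n g -> answered 1 rounds s -> ready s -> reg s 9 < n * n - 1 ->
  stmt_ok W phase_value s /\ reg (run phase_value s) 13 = pair_value s (reg s 9) /\
  pair_value s (reg s 9) < 2 ^ W /\
  same_except [13; 18; 19] s (run phase_value s) /\ mem (run phase_value s) = mem s.
Proof.
  intros hg hans [(r0 & r5 & r6 & r7 & r8) hw] hp.
  pose proof M_large as (m1 & m2 & m3 & m4).
  destruct (pair_value_spec s (reg s 9) hg hans hp) as (hb & _ & hle).
  set (p := reg s 9) in *.
  destruct (divmod_lt n n p ltac:(lia)) as [h1 h2].
  (* The choice [c = d = 0] bounds the value by [6 * B], which excludes overflow. *)
  specialize (hle 0 0 n_pos n_pos).
  assert (total (p / n) (p mod n) 0 0 <= 6 * B) as h6.
  { unfold total.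
    pose proof (wt_le (p / n) (p mod n)). pose proof (wt_le (p / n) 0).
    pose proof (wt_le (p mod n) 0). pose proof (wt_le 0 0). lia. }
  refine ((fun H => conj (proj1 H) (conj (proj2 H) (conj _ (conj _ _)))) _).
  - lia.
  - intros x hx. unfold phase_value; cbn [run]. unfold set_reg; cbn [reg].
    destruct (Nat.eqb_spec x 13), (Nat.eqb_spec x 18), (Nat.eqb_spec x 19);
      try reflexivity; subst x; cbn in hx; lia.
  - reflexivity.
  - unfold phase_value. simp. fold p. rewrite r0, r5, r6, r7.
    rewrite (hw p ltac:(lia)).
    unfold pair_value in *. unfold phase_end, base in *.
    set (a := p / n) in *. set (b := p mod n) in *.
    pose proof (pair_lt n a b h1 h2).
    pose proof (L_mul (2 * (n * n - 1 - (a * n + b)) + 4 * (n - 1 - a)) ltac:(lia)).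
    set (x := L * (2 * (n * n - 1 - (a * n + b)) + 4 * (n - 1 - a))) in *.
    set (y := mem s 3 _) in *. pose proof (wt_le a b).
    clearbody x y a b.
    assert (6 * n * a <= 6 * (n * n)) by nia.
    split; [|lia]. repeat split; lia.
Qed.

Lemma clique_value_spec s a b :
  ready s -> reg s 18 = a -> reg s 19 = b -> a < n -> b < n -> reg s 9 < n * n ->
  stmt_ok W clique_value s /\
  reg (run clique_value s) 13 = total a b (reg s 9 / n) (reg s 9 mod n) /\
  same_except [11; 12; 13] s (run clique_value s) /\ mem (run clique_value s) = mem s.
Proof.
  intros [(r0 & r5 & r6 & r7 & r8) hw] r18 r19 ha hb hp.
  pose proof M_large as (m1 & m2 & m3 & m4).
  set (p := reg s 9) in *.
  destruct (divmod_lt n n p hp) as [h1 h2].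
  refine ((fun H => conj (proj1 H) (conj (proj2 H) (conj _ _))) _).
  - intros x hx. unfold clique_value; cbn [run]. unfold set_reg; cbn [reg].
    destruct (Nat.eqb_spec x 11), (Nat.eqb_spec x 12), (Nat.eqb_spec x 13);
      try reflexivity; subst x; cbn in hx; lia.
  - reflexivity.
  - assert (forall i j, i < n -> j < n -> mem s 2 (i * n + j) = wt i j) as hij.
    { intros i j hi hj. rewrite hw by now apply pair_lt.
      destruct (divmod_eq n i j hj) as [-> ->]. reflexivity. }
    unfold clique_value. simp. fold p. rewrite r0, r18, r19, (hw p hp).
    set (c := p / n) in *. set (d := p mod n) in *. rewrite !hij by auto.
    pose proof (pair_lt n a b ha hb). pose proof (pair_lt n a c ha h1).
    pose proof (pair_lt n a d ha h2). pose proof (pair_lt n b c hb h1).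
    pose proof (pair_lt n b d hb h2).
    pose proof (wt_le a b). pose proof (wt_le a c). pose proof (wt_le a d).
    pose proof (wt_le b c). pose proof (wt_le b d). pose proof (wt_le c d).
    unfold total. split; [|reflexivity]. repeat split; lia.
Qed.

Lemma completed_lt i j : wt i j < B -> g i j = Some (wt i j).
Proof. unfold completed. destruct (g i j); auto; lia. Qed.

(** A sum below [B] has no summand equal to the substitute [B], so all six pairs are edges; the
    absence of loops makes the vertices distinct. *)
Lemma total_clique a b c d :
  (forall u, g u u = None) -> (forall u v, g u v = g v u) -> total a b c d < B ->
  is_clique g 4 [a; b; c; d].
Proof.
  intros hirr hsym h. unfold total in h.
  pose proof (completed_lt a b ltac:(lia)) as h1.
  pose proof (completed_lt a c ltac:(lia)) as h2.
  pose proof (completed_lt a d ltac:(lia)) as h3.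
  pose proof (completed_lt b c ltac:(lia)) as h4.
  pose proof (completed_lt b d ltac:(lia)) as h5.
  pose proof (completed_lt c d ltac:(lia)) as h6.
  assert (forall x y w, g x y = Some w -> x <> y) as hne by (intros x y w e ->; congruence).
  split; [reflexivity|split].
  - pose proof (hne _ _ _ h1). pose proof (hne _ _ _ h2). pose proof (hne _ _ _ h3).
    pose proof (hne _ _ _ h4). pose proof (hne _ _ _ h5). pose proof (hne _ _ _ h6).
    repeat constructor; cbn; intuition congruence.
  - intros u v hu hv huv. cbn in hu, hv.
    destruct hu as [<-|[<-|[<-|[<-|[]]]]], hv as [<-|[<-|[<-|[<-|[]]]]];
      try contradiction; try congruence; rewrite hsym; congruence.
Qed.

(** On a clique no entry of the completed matrix is a substitute, so both notions of weight
    agree. *)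
Lemma clique_total l :
  is_clique g 4 l -> Forall (fun u => u < n) l ->
  exists a b c d, l = [a; b; c; d] /\ a <> b /\ a < n /\ b < n /\ c < n /\ d < n /\
    clique_weight g l = total a b c d /\
    (forall x y, In x l -> In y l -> x <> y -> exists w, g x y = Some w) /\ NoDup l.
Proof.
  intros (hl & hnd & hadj) hn.
  destruct l as [|a [|b [|c [|d [|e l]]]]]; cbn in hl; try lia.
  exists a, b, c, d.
  assert (forall x, In x [a; b; c; d] -> x < n) as hin by now apply Forall_forall.
  assert (forall x y, In x [a; b; c; d] -> In y [a; b; c; d] -> x <> y ->
            exists w, g x y = Some w) as hadj'.
  { intros x y hx hy hxy. specialize (hadj x y hx hy hxy).
    destruct (g x y); [eauto|contradiction]. }
  assert (forall x y, In x [a; b; c; d] -> In y [a; b; c; d] -> x <> y ->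
            weight g x y = wt x y) as hwt.
  { intros x y hx hy hxy. destruct (hadj' x y hx hy hxy) as [w e].
    unfold weight, completed. now rewrite e. }
  inversion hnd as [|? ? na hnd1]; subst. inversion hnd1 as [|? ? nb hnd2]; subst.
  inversion hnd2 as [|? ? nc hnd3]; subst. cbn in na, nb, nc.
  repeat split; auto; try (apply hin; cbn; tauto).
  cbn [clique_weight map]. unfold list_sum; cbn [fold_right].
  rewrite !hwt by (cbn; intuition congruence). unfold total. lia.
Qed.

Lemma search_runs s :
  is_graph n g -> (forall i j w, g i j = Some w -> 6 * w < B) ->
  ready s -> answered 1 rounds s ->
  exists s' t, runs W s search t s' /\ clique_output n g 4 s' /\
    t <= (stmt_cost (phase_value;; keep_min) + stmt_cost (clique_value;; keep_min) + 4)
         * (n * n)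
         + (stmt_cost (start_min (V 5 - C 1)) + stmt_cost (select_pair;; start_min (V 5))
            + stmt_cost output + 4).
Proof.
  intros hg hlight hs hans. pose proof W_pos as hW.
  pose proof M_large as (m1 & m2 & m3 & m4).
  pose proof hg as (hdom & hsym & hirr).
  set (f1 := pair_value s).
  destruct (start_min_spec (V 5 - C 1)%expr (n * n - 1) f1 s hs ltac:(lia))
    as (ok1 & hs1 & y9 & y10 & hl1).
  { intros s' hs'. assert (reg s' 5 = n * n) as r5 by apply hs'. simp. rewrite r5.
    repeat split; lia. }
  pose proof (runs_compile W (start_min (V 5 - C 1)) s hW eq_refl ok1) as x1.
  set (s1 := run (start_min (V 5 - C 1)) s) in *.
  assert (mem s1 = mem s) as hm1 by reflexivity.
  clearbody s1.
  set (c1 := stmt_cost (phase_value;; keep_min)).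
  set (I1 := fun k t s' => ready s' /\ reg s' 9 = k /\ reg s' 10 = n * n - 1 /\
    mem s' = mem s /\ least f1 k s' /\ t <= c1 * k).
  destruct (runs_loop W I1 (n * n - 1) (compile (phase_value;; keep_min)) s1)
    as (t2 & s2 & x2 & hs2 & _ & _ & hm2 & hl2 & ht2); auto.
  { intros k t s2 _ (_ & h1 & h2 & _). auto. }
  { intros k t s2 hk (hr & h9 & h10 & hm & hl & ht).
    assert (answered 1 rounds s2) as hans2 by (unfold answered; now rewrite hm).
    destruct (phase_value_spec s2 hg hans2 hr ltac:(lia)) as (ok2 & hv & hb & same & hm').
    set (s3 := run phase_value s2) in *.
    assert (pair_value s2 (reg s2 9) = f1 k) as hf
      by (unfold f1, pair_value; now rewrite hm, h9).
    rewrite hf in hv, hb.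
    assert (reg s3 9 = k) as h39 by (rewrite same; [exact h9|cbn; lia]).
    assert (least f1 k s3) as hl0 by (unfold least; rewrite !same by (cbn; lia); exact hl).
    destruct (keep_min_spec f1 k s3 hl0 h39 hv ltac:(lia) hb)
      as (ok3 & hl3 & h9' & same3 & hm3).
    exists c1, (run (phase_value;; keep_min) s2). split.
    - apply runs_compile; auto. exact (conj ok2 ok3).
    - change (run (phase_value;; keep_min) s2) with (run keep_min s3).
      refine (conj _ (conj h9' (conj _ (conj _ (conj hl3 _))))).
      + eapply ready_same; [exact hr| |intros; now rewrite hm3, hm'].
        intros x hx. rewrite same3, same by (cbn; lia). reflexivity.
      + rewrite same3, same by (cbn; lia). exact h10.
      + now rewrite hm3, hm'.
      + lia. }
  { refine (conj hs1 (conj y9 (conj y10 (conj hm1 (conj hl1 _))))). lia. }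
  pose proof hl2 as (g1 & g2 & g3 & g4).
  set (best1 := reg s2 14) in *. set (p := reg s2 15) in *.
  set (a := p / n). set (b := p mod n).
  destruct (divmod_lt n n p g4) as [ha hb]. fold a b in ha, hb.
  set (s3 := run select_pair s2).
  assert (reg s2 0 = n) as r0 by apply hs2.
  assert (ready s3) as hs3 by (eapply ready_same; [exact hs2|ready_regs|reflexivity]).
  assert (stmt_ok W select_pair s2) as ok3.
  { unfold select_pair. simp. rewrite r0. fold p. fold a b. repeat split; lia. }
  assert (reg s3 18 = a /\ reg s3 19 = b) as [h18 h19].
  { unfold s3, select_pair. simp. rewrite r0. auto. }
  set (f2 := fun q => total a b (q / n) (q mod n)).
  destruct (start_min_spec (V 5) (n * n) f2 s3 hs3 ltac:(lia))
    as (ok4 & hs4 & z9 & z10 & hl4).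
  { intros s' hs'. assert (reg s' 5 = n * n) as r5 by apply hs'. simp. rewrite r5.
    repeat split; lia. }
  assert (runs W s2 (compile (select_pair;; start_min (V 5)))
    (stmt_cost (select_pair;; start_min (V 5))) (run (start_min (V 5)) s3)) as x4.
  { apply (runs_compile W (select_pair;; start_min (V 5)) s2); auto.
    exact (conj ok3 ok4). }
  assert (reg (run (start_min (V 5)) s3) 18 = a /\ reg (run (start_min (V 5)) s3) 19 = b)
    as [i18 i19] by (split; assumption).
  set (s4 := run (start_min (V 5)) s3) in *. clearbody s4.
  set (c2 := stmt_cost (clique_value;; keep_min)).
  set (I2 := fun k t s' => ready s' /\ reg s' 9 = k /\ reg s' 10 = n * n /\
    (reg s' 18 = a /\ reg s' 19 = b) /\ least f2 k s' /\ t <= c2 * k).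
  destruct (runs_loop W I2 (n * n) (compile (clique_value;; keep_min)) s4)
    as (t5 & s5 & x5 & hs5 & _ & _ & [j18 j19] & hl5 & ht5); auto.
  { intros k t s5 _ (_ & h1 & h2 & _). auto. }
  { intros k t s5 hk (hr & h9 & h10 & [k18 k19] & hl & ht).
    destruct (clique_value_spec s5 a b hr k18 k19 ha hb ltac:(lia)) as (ok5 & hv & same & hm').
    rewrite h9 in hv. change (total a b (k / n) (k mod n)) with (f2 k) in hv.
    set (s6 := run clique_value s5) in *.
    assert (reg s6 9 = k) as h69 by (rewrite same; [exact h9|cbn; lia]).
    assert (f2 k < 2 ^ W) as hf.
    { unfold f2, total. set (c := k / n). set (d := k mod n).
      pose proof (wt_le a b). pose proof (wt_le a c). pose proof (wt_le a d).
      pose proof (wt_le b c). pose proof (wt_le b d). pose proof (wt_le c d). lia. }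
    assert (least f2 k s6) as hl0 by (unfold least; rewrite !same by (cbn; lia); exact hl).
    destruct (keep_min_spec f2 k s6 hl0 h69 hv hk hf) as (ok6 & hl6 & h9' & same6 & hm6).
    exists c2, (run (clique_value;; keep_min) s5). split.
    - apply runs_compile; auto. exact (conj ok5 ok6).
    - change (run (clique_value;; keep_min) s5) with (run keep_min s6).
      refine (conj _ (conj h9' (conj _ (conj (conj _ _) (conj hl6 _))))).
      + eapply ready_same; [exact hr| |intros; now rewrite hm6, hm'].
        intros x hx. rewrite same6, same by (cbn; lia). reflexivity.
      + rewrite same6, same by (cbn; lia). exact h10.
      + rewrite same6, same by (cbn; lia). exact k18.
      + rewrite same6, same by (cbn; lia). exact k19.
      + lia. }
  { refine (conj hs4 (conj z9 (conj z10 (conj (conj i18 i19) (conj hl4 _))))). lia. }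
  destruct hl5 as (q1 & q2 & q3 & q4).
  set (best2 := reg s5 14) in *. set (q := reg s5 15) in *.
  set (c := q / n). set (d := q mod n).
  destruct (divmod_lt n n q q4) as [hc hd]. fold c in hc. fold d in hd.
  assert (reg s5 0 = n /\ reg s5 8 = B) as [v0 v8] by (split; apply hs5).
  pose proof hs5 as [_ hw5].
  assert (stmt_ok W output s5) as ok6.
  { unfold output. simp. rewrite v0, j18, j19. fold q. fold c d. repeat split; try lia.
    destruct (_ <? _); lia. }
  pose proof (runs_compile W output s5 hW eq_refl ok6) as x6.
  (* A clique makes the first scan end below [B], so its index is a genuine pair whose value is
     attained by some [c1'] and [d1']; the second scan meets these, hence does at least as well as
     the clique. *)
  assert (forall l, is_clique g 4 l -> Forall (fun u => u < n) l ->
            clique_weight g l < B /\ best2 <= clique_weight g l) as hbest.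
  { intros l h1 h2.
    destruct (clique_total l h1 h2)
      as (a' & b' & c' & d' & -> & hne & ha' & hb' & hc' & hd' & -> & hadj & hnd).
    assert (forall x y, In x [a'; b'; c'; d'] -> In y [a'; b'; c'; d'] -> x <> y ->
              6 * wt x y < B) as hlt.
    { intros x y hx hy hxy. destruct (hadj x y hx hy hxy) as [w e].
      unfold completed. rewrite e. eapply hlight, e. }
    assert (total a' b' c' d' < B) as hF.
    { inversion hnd as [|? ? na hnd1]; subst. inversion hnd1 as [|? ? nb hnd2]; subst.
      inversion hnd2 as [|? ? nc hnd3]; subst. cbn in na, nb, nc. unfold total.
      pose proof (hlt a' b' ltac:(cbn; tauto) ltac:(cbn; tauto) ltac:(tauto)).
      pose proof (hlt a' c' ltac:(cbn; tauto) ltac:(cbn; tauto) ltac:(intuition congruence)).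
      pose proof (hlt a' d' ltac:(cbn; tauto) ltac:(cbn; tauto) ltac:(intuition congruence)).
      pose proof (hlt b' c' ltac:(cbn; tauto) ltac:(cbn; tauto) ltac:(intuition congruence)).
      pose proof (hlt b' d' ltac:(cbn; tauto) ltac:(cbn; tauto) ltac:(intuition congruence)).
      pose proof (hlt c' d' ltac:(cbn; tauto) ltac:(cbn; tauto) ltac:(intuition congruence)).
      lia. }
    split; auto.
    pose proof (pair_lt_last n a' b' ha' hb' hne) as hp.
    destruct (divmod_eq n a' b' hb') as [e1 e2].
    assert (best1 <= total a' b' c' d') as h3.
    { etransitivity; [apply (g1 _ hp)|].
      destruct (pair_value_spec s _ hg hans hp) as (_ & _ & hle).
      rewrite e1, e2 in hle. now apply hle. }
    destruct (g3 ltac:(lia)) as [hp' h4].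
    destruct (pair_value_spec s p hg hans hp') as (_ & (c1' & d1' & h5 & h6 & h7) & _).
    fold f1 a b in h7. specialize (q1 (c1' * n + d1') (pair_lt n _ _ h5 h6)).
    unfold f2 in q1. destruct (divmod_eq n c1' d1' h6) as [e3 e4].
    rewrite e3, e4 in q1. lia. }
  exists (run output s5), (stmt_cost (start_min (V 5 - C 1)) + ((t2 + 2 * (n * n - 1) + 2) +
    (stmt_cost (select_pair;; start_min (V 5)) + ((t5 + 2 * (n * n) + 2) +
      stmt_cost output)))).
  split; [|split].
  - eapply runs_seq; [exact x1|]. eapply runs_seq; [exact x2|].
    eapply runs_seq; [exact x4|]. eapply runs_seq; [exact x5|exact x6].
  - unfold clique_output.
    assert (map (reg (run output s5)) (seq 1 4) = [a; b; c; d]) as hmap.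
    { unfold output. simp. now rewrite v0, j18, j19. }
    assert (reg (run output s5) 0 = if best2 <? B then 1 else 0) as hout.
    { unfold output. simp. now rewrite v8. }
    rewrite hmap, hout. destruct (Nat.ltb_spec best2 B) as [h|h].
    + left. split; [reflexivity|]. destruct (q3 h) as [_ q3'].
      assert (is_clique g 4 [a; b; c; d]) as hcl.
      { apply total_clique; auto. unfold f2 in q3'. fold c d in q3'. lia. }
      assert (Forall (fun u => u < n) [a; b; c; d]) as hall by (repeat constructor; auto).
      split; [exact hcl|split; [exact hall|]].
      intros l h1 h2.
      destruct (clique_total _ hcl hall)
        as (a' & b' & c' & d' & e & _ & _ & _ & _ & _ & -> & _).
      injection e as <- <- <- <-. destruct (hbest l h1 h2) as [_ h3].
      unfold f2 in q3'. fold c d in q3'. lia.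
    + right. split; [reflexivity|]. intros (l & h1 & h2).
      destruct (hbest l h1 h2). lia.
  - fold c1 c2. assert (c1 * (n * n - 1) <= c1 * (n * n)) by (apply Nat.mul_le_mono_l; lia).
    lia.
Qed.

(** * Legality of the update sequences *)

Lemma insertions_legal m k :
  (k + m <= rounds) -> legal_seq (12 * n) (graph_after k) (map insertion (seq k m)).
Proof.
  revert k. induction m as [|m IH]; intros k hk; cbn [seq map legal_seq]; auto.
  pose proof (ends_lt k ltac:(lia)) as (h1 & h2 & h3).
  split; [|apply (IH (S k)); lia].
  repeat split; auto. apply stage_fresh. lia.
Qed.

Lemma insertions_fold m k :
  fold_left apply_update (map insertion (seq k m)) (graph_after k) = graph_after (k + m).
Proof.
  revert k. induction m as [|m IH]; intros k; cbn [seq map fold_left].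
  - f_equal; lia.
  - change (apply_update (graph_after k) (insertion k)) with (graph_after (S k)).
    rewrite IH. f_equal; lia.
Qed.

Lemma deletions_legal k : k <= rounds -> legal_seq (12 * n) (graph_after k) (deletions k).
Proof.
  induction k as [|k IH]; intros hk; cbn [deletions legal_seq]; auto.
  rewrite deletion_stage by lia. split; [|apply IH; lia].
  cbn [legal deletion].
  destruct (stage_edge n L M wt (S k) (decode n k)) as [-> _];
    [lia|apply decode_ok; lia|rewrite encode_decode; lia|discriminate].
Qed.

Lemma deletions_fold k :
  k <= rounds -> fold_left apply_update (deletions k) (graph_after k) = empty_graph.
Proof.
  induction k as [|k IH]; intros hk; cbn [deletions fold_left]; auto.
  rewrite deletion_stage by lia. apply IH; lia.
Qed.

Lemma stage_weights k : k <= rounds -> weights_le (graph_after k) (3 * M).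
Proof.
  intros hk u v w H. apply stage_inv in H; auto.
  destruct H as (e & he & hek & -> & _).
  rewrite <- (decode_encode n e he). apply len_le. lia.
Qed.
End Programs.

Local Ltac splits := repeat match goal with |- _ /\ _ => split end.

(** * Preparing the constants and the completed weights *)

Definition setup_start : stmt :=
  5 ::= V 0 * V 0;; 8 ::= C 0;; 9 ::= C 0;; 10 ::= V 5.

(** The bound on the weights is their sum rather than their maximum: it takes no comparison and is
    at most [n * n * U], still polynomial in [n + U]. *)
Definition add_weight : stmt := 8 ::= V 8 + G 1 (V 9);; next_round.

Definition setup_constants : stmt :=
  8 ::= C 6 * V 8 + C 1;; 6 ::= C 5 * V 8 + C 1;; 7 ::= C 7 * V 5 * V 6;; 9 ::= C 0.

Definition complete_entry : stmt :=
  Cond (G 0 (V 9)) (Put 2 (V 9) (G 1 (V 9))) (Put 2 (V 9) (V 8));; next_round.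

Definition setup : com :=
  Seq (compile setup_start) (Seq (loop (compile add_weight))
    (Seq (compile setup_constants) (loop (compile complete_entry)))).

(** [100 * M] for the constants computed by [setup_constants] from a sum
    of all weights. *)
Lemma constants_bound n U sw :
  0 < n -> sw <= n * n * U ->
  100 * (7 * (n * n) * (5 * (6 * sw + 1) + 1)) < (n + U + 2) ^ 20.
Proof.
  intros hn hS. set (X := n + U + 2).
  assert (n * n <= X ^ 2) as h2 by (unfold X; cbn; nia).
  assert (n * n * U <= X ^ 3) as h3.
  { replace (X ^ 3) with (X ^ 2 * X) by (cbn; lia).
    apply Nat.mul_le_mono; unfold X in *; lia. }
  assert (2 ^ 7 <= X ^ 7) as h7 by (apply Nat.pow_le_mono_l; unfold X; lia).
  assert (2 ^ 8 <= X ^ 8) as h8 by (apply Nat.pow_le_mono_l; unfold X; lia).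
  change (2 ^ 7) with 128 in h7. change (2 ^ 8) with 256 in h8.
  assert (1 <= X ^ 3) as h1 by (apply Nat.neq_0_lt_0, Nat.pow_nonzero; unfold X; lia).
  assert (1 <= X ^ 5) as h5 by (apply Nat.neq_0_lt_0, Nat.pow_nonzero; unfold X; lia).
  (* Powers of [X] absorb the constants: [X ^ 7] is at least [128 > 100], [X ^ 8] at least
     [256 > 252], and [X ^ 5] covers the product of [n * n] and [n * n * U]. *)
  replace (X ^ 20) with (X ^ 7 * (X ^ 8 * X ^ 5)) by (rewrite <- !Nat.pow_add_r; reflexivity).
  assert (7 * (n * n) * (5 * (6 * sw + 1) + 1) <= 252 * X ^ 5) as h.
  { replace (252 * X ^ 5) with ((7 * X ^ 2) * (36 * X ^ 3)).
    - apply Nat.mul_le_mono; lia.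
    - replace (X ^ 5) with (X ^ 2 * X ^ 3) by (rewrite <- Nat.pow_add_r; reflexivity). lia. }
  assert (252 * X ^ 5 <= X ^ 8 * X ^ 5) as h9 by (apply Nat.mul_le_mono_r; lia).
  assert (128 * (X ^ 8 * X ^ 5) <= X ^ 7 * (X ^ 8 * X ^ 5)) by now apply Nat.mul_le_mono_r.
  lia.
Qed.

Lemma setup_runs W n U g s :
  0 < n -> is_graph n g -> weights_le g U -> (n + U + 2) ^ 20 <= 2 ^ W ->
  reg s 0 = n -> (forall i, mem s 0 i = mem (graph_state n g) 0 i) ->
  (forall i, mem s 1 i = mem (graph_state n g) 1 i) -> simulates zero_state s ->
  exists sw s' t,
    let B := 6 * sw + 1 in let L := 5 * B + 1 in let M := 7 * (n * n) * L in
    runs W s setup t s' /\ ready n B L M g s' /\ simulates zero_state s' /\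
    (forall i j w, g i j = Some w -> w <= sw) /\ 100 * M < (n + U + 2) ^ 20 /\
    t <= (stmt_cost add_weight + stmt_cost complete_entry + 4) * (n * n)
         + (stmt_cost setup_start + stmt_cost setup_constants + 4).
Proof.
  intros hn (hdom & hsym & hirr) hU hW r0 hm0 hm1 hsim.
  (* Stated for every [sw] in this range, since the partial sums in the loop must avoid overflow as
     well as the final one. *)
  assert (forall sw, sw <= n * n * U ->
    0 < n * n /\ n <= n * n /\ n * n <= 2 ^ W /\ 100 * sw < 2 ^ W /\
    100 * (7 * (n * n) * (5 * (6 * sw + 1) + 1)) < 2 ^ W) as hS.
  { intros sw h. pose proof (constants_bound n U sw hn h) as h1.
    assert (0 < n * n) by nia. assert (n <= n * n) by nia.
    split; [auto|split; [auto|]]. split; [nia|split; nia]. }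
  destruct (hS 0 ltac:(lia)) as (p1 & p2 & p3 & _ & p5).
  assert (0 < W) as hW0 by (destruct W; [cbn in p5; nia|lia]).
  set (s1 := run setup_start s).
  assert (runs W s (compile setup_start) (stmt_cost setup_start) s1) as x1.
  { apply runs_compile; auto. unfold setup_start. simp. rewrite !r0. repeat split; lia. }
  assert (reg s1 0 = n /\ reg s1 5 = n * n /\ reg s1 8 = 0 /\ reg s1 9 = 0 /\
    reg s1 10 = n * n /\ mem s1 = mem s /\ simulates zero_state s1)
    as (a0 & a5 & a8 & a9 & a10 & am & asim).
  { unfold s1. splits; try (cbn; rewrite ?r0; reflexivity); try exact r0.
    now apply run_simulates. }
  clearbody s1.
  set (c1 := stmt_cost add_weight).
  set (I1 := fun k t s' => reg s' 0 = n /\ reg s' 5 = n * n /\ reg s' 9 = k /\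
    reg s' 10 = n * n /\ mem s' = mem s /\ simulates zero_state s' /\
    (forall i, i < k -> mem s 1 i <= reg s' 8) /\ reg s' 8 <= k * U /\ t <= c1 * k).
  assert (forall i, mem s 1 i <= U) as hmU.
  { intros i. rewrite hm1. cbn. destruct (g (i / n) (i mod n)) eqn:E; [eapply hU, E|lia]. }
  destruct (runs_loop W I1 (n * n) (compile add_weight) s1)
    as (t2 & s2 & x2 & b0 & b5 & b9 & b10 & bm & bsim & bmax & b8 & bt); auto.
  { intros k t s2 _ (_ & _ & h1 & h2 & _). auto. }
  { intros k t s2 hk (h0 & h5 & h9 & h10 & hm & hsim2 & hmax & h8 & ht).
    pose proof (hmU k) as hk1.
    assert (k * U <= n * n * U) as hk2 by (apply Nat.mul_le_mono_r; lia).
    assert (S k * U <= n * n * U) as hk3 by (apply Nat.mul_le_mono_r; lia).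
    destruct (hS (reg s2 8 + mem s 1 k) ltac:(lia)) as (_ & _ & _ & hb & _).
    exists c1, (run add_weight s2). split.
    - apply runs_compile; auto. unfold add_weight, next_round. simp. rewrite h9, hm. lia.
    - unfold I1. splits; try assumption; try (now apply run_simulates).
      + cbn. rewrite h9. lia.
      + intros i hi. cbn. rewrite h9, hm.
        destruct (Nat.eq_dec i k) as [->|]; [lia|]. specialize (hmax i ltac:(lia)). lia.
      + cbn. rewrite h9, hm. lia.
      + lia. }
  { unfold I1. splits; try assumption; try lia. }
  set (sw := reg s2 8) in *.
  destruct (hS sw b8) as (_ & _ & _ & q4 & q5).
  set (B := 6 * sw + 1). set (L := 5 * B + 1). set (M := 7 * (n * n) * L).
  assert (7 * L <= M) by (unfold M; nia).
  assert (42 * (n * n) <= M) by (unfold M, L, B; nia).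
  fold B in q5. fold L in q5. fold M in q5.
  assert (B < L) by (unfold L; lia).
  set (s3 := run setup_constants s2).
  assert (runs W s2 (compile setup_constants) (stmt_cost setup_constants) s3) as x3.
  { apply runs_compile; auto. unfold setup_constants. simp. fold sw. rewrite b5.
    fold B. fold L. fold M. repeat split; try lia; unfold L, B in *; lia. }
  assert (reg s3 0 = n /\ reg s3 5 = n * n /\ reg s3 6 = L /\ reg s3 7 = M /\
    reg s3 8 = B /\ reg s3 9 = 0 /\ reg s3 10 = n * n /\ mem s3 = mem s /\
    simulates zero_state s3) as (d0 & d5 & d6 & d7 & d8 & d9 & d10 & dm & dsim).
  { unfold s3. splits; try assumption; try reflexivity; try (now apply run_simulates).
    simp. now rewrite b5. }
  clearbody s3.
  set (c2 := stmt_cost complete_entry).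
  set (I2 := fun k t s' => (reg s' 0 = n /\ reg s' 5 = n * n /\ reg s' 6 = L /\
    reg s' 7 = M /\ reg s' 8 = B) /\ reg s' 9 = k /\ reg s' 10 = n * n /\
    mem s' 0 = mem s 0 /\ mem s' 1 = mem s 1 /\ simulates zero_state s' /\
    (forall i, i < k -> mem s' 2 i = completed g B (i / n) (i mod n)) /\ t <= c2 * k).
  destruct (runs_loop W I2 (n * n) (compile complete_entry) s3)
    as (t4 & s4 & x4 & hr & _ & _ & _ & _ & fsim & fw & ft); auto.
  { intros k t s4 _ (_ & h1 & h2 & _). auto. }
  { intros k t s4 hk (hr & h9 & h10 & hm & hm' & hsim4 & hw & ht).
    exists c2, (run complete_entry s4). split.
    - apply runs_compile; auto. unfold complete_entry, next_round. simp.
      destruct (_ =? 0); simp; rewrite h9; lia.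
    - assert (forall i, i < S k -> mem (run complete_entry s4) 2 i =
                completed g B (i / n) (i mod n)) as hnew.
      { intros i hi. unfold complete_entry, next_round. simp.
        rewrite h9, hm, hm', hm0, hm1. cbn [graph_state mem]. unfold completed.
        destruct (Nat.eq_dec i k) as [->|hne].
        - destruct (g (k / n) (k mod n)); simp; rewrite Nat.eqb_refl; [reflexivity|apply hr].
        - destruct (g (k / n) (k mod n)); simp; rewrite (proj2 (Nat.eqb_neq i k)) by auto;
            apply hw; lia. }
      assert (simulates zero_state (run complete_entry s4)) as hsim5
        by now apply run_simulates.
      revert hnew hsim5. unfold I2, complete_entry, next_round; cbn [run].
      destruct (_ =? 0); intros; splits; try assumption; try apply hr;
        try (cbn; rewrite h9; lia); lia. }
  { unfold I2. splits; try assumption; try lia; rewrite dm; reflexivity. }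
  exists sw, s4, (stmt_cost setup_start + ((t2 + 2 * (n * n) + 2) +
    (stmt_cost setup_constants + (t4 + 2 * (n * n) + 2)))).
  cbn zeta. fold B. fold L. fold M.
  split; [|split; [|split; [exact fsim|split; [|split]]]].
  - eapply runs_seq; [exact x1|]. eapply runs_seq; [exact x2|].
    eapply runs_seq; [exact x3|exact x4].
  - split; [exact hr|exact fw].
  - intros i j w e. destruct (hdom i j w e) as [hi hj].
    specialize (bmax (i * n + j) (pair_lt n i j hi hj)).
    rewrite hm1 in bmax. cbn in bmax.
    destruct (divmod_eq n i j hj) as [e1 e2]. rewrite e1, e2, e in bmax. exact bmax.
  - now apply constants_bound.
  - fold c1 c2. lia.
Qed.

(** * The reductions and the lower bounds *)

Definition clique_program (driver : com) : com :=
  If 0 (Seq setup (Seq driver search)) Skip.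

(** The two reductions differ only in the driver, which enters here through the distances it leaves
    behind and its running time. *)
Lemma clique_program_solves driver T C0 c :
  (forall W n B L M g s,
     0 < n -> 1 <= B -> L = 5 * B + 1 -> M = 7 * (n * n) * L -> 100 * M < 2 ^ W ->
     (forall i j w, g i j = Some w -> w <= B) ->
     word_size_ok c (12 * n) (3 * M) W ->
     ready n B L M g s -> simulates zero_state s ->
     exists s' t, runs W s driver t s' /\ ready n B L M g s' /\
       answered n B L M g 1 (11 * (n * n)) s' /\ t <= T (12 * n) + C0 * (n * n + 1)) ->
  exists C1, solves_min_clique 4 (clique_program driver)
               (fun n => T (12 * n) + C1 * (n * n + 1)).
Proof.
  intros hdriver.
  set (k1 := stmt_cost add_weight + stmt_cost complete_entry + 4).
  set (k2 := stmt_cost setup_start + stmt_cost setup_constants + 4).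
  set (k3 := stmt_cost (phase_value;; keep_min) + stmt_cost (clique_value;; keep_min) + 4).
  set (k4 := stmt_cost (start_min (V 5 - C 1)) + stmt_cost (select_pair;; start_min (V 5))
             + stmt_cost output + 4).
  (* [(n + U + 2) ^ 20] exceeds [100 * M], hence also the size [12 * n + 3 * M + 2] of the
     constructed instance. Its power [c] provides the words that the dynamic algorithm asks for; the
     extra 20 serves the arithmetic of the reduction. *)
  exists (k1 + k2 + C0 + k3 + k4 + 2), (20 * (c + 1)). intros n g U W hg hU hX.
  unfold word_size_ok in hX. set (s := load_regs (graph_state n g) [n]).
  (* Without vertices the program halts at once; register 0 still holds [n = 0], the correct
     answer. *)
  destruct (Nat.eq_dec n 0) as [->|hn].
  { exists 2, s. split; [|split; [lia|right; split; [reflexivity|]]].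
    - apply exec_if_false; [reflexivity|constructor].
    - intros (l & (hl & _) & hall). destruct l; [discriminate hl|].
      inversion hall. lia. }
  assert (0 < n) as hpos by lia.
  assert ((n + U + 2) ^ 20 <= 2 ^ W) as hX20.
  { etransitivity; [|exact hX]. apply Nat.pow_le_mono_r; lia. }
  assert (simulates zero_state s) as hsim.
  { split; [intros x|intros a i]; cbn; destruct x || reflexivity; reflexivity. }
  destruct (setup_runs W n U g s hpos hg hU hX20 eq_refl ltac:(reflexivity)
              ltac:(reflexivity) hsim)
    as (sw & s1 & t1 & x1 & hr1 & hsim1 & hS & hM & ht1).
  fold k1 k2 in ht1.
  set (B := 6 * sw + 1) in *. set (L := 5 * B + 1) in *. set (M := 7 * (n * n) * L) in *.
  assert (1 <= B) as hB by (unfold B; lia).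
  assert (100 * M < 2 ^ W) as hMW by lia.
  assert (forall i j w, g i j = Some w -> w <= B) as hgB.
  { intros i j w e. specialize (hS i j w e). unfold B; lia. }
  assert (word_size_ok c (12 * n) (3 * M) W) as hword.
  { unfold word_size_ok. etransitivity; [|exact hX].
    destruct (M_large W n B L M hpos hB eq_refl eq_refl hMW) as (m1 & m2 & _).
    etransitivity; [apply Nat.pow_le_mono_l with (b := (n + U + 2) ^ 20); lia|].
    rewrite <- Nat.pow_mul_r. apply Nat.pow_le_mono_r; lia. }
  destruct (hdriver W n B L M g s1 hpos hB eq_refl eq_refl hMW hgB hword hr1 hsim1)
    as (s2 & t2 & x2 & hr2 & hans & ht2).
  destruct (search_runs W n B L M g hpos hB eq_refl eq_refl hMW hgB s2 hg) as
    (s3 & t3 & x3 & hout & ht3); auto.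
  { intros i j w e. specialize (hS i j w e). unfold B; lia. }
  fold k3 k4 in ht3.
  destruct (runs_seq _ _ _ _ _ _ _ _ x1 (runs_seq _ _ _ _ _ _ _ _ x2 x3) s (agree_refl s))
    as (t & s' & x & ht & [hreg _]).
  exists (S t), s'. split; [|split].
  - apply exec_if_true; [exact hn|exact x].
  - assert (1 <= n * n) by nia. nia.
  - unfold clique_output in *.
    rewrite (hreg 0) by lia.
    replace (map (reg s') (seq 1 4)) with (map (reg s3) (seq 1 4)); auto.
    cbn. rewrite !hreg by lia. reflexivity.
Qed.

Lemma incremental_clique A T :
  solves_incremental_stSP A T ->
  exists C1, solves_min_clique 4 (clique_program (inc_driver A))
               (fun n => T (12 * n) + C1 * (n * n + 1)).
Proof.
  intros [c hA].
  eapply clique_program_solves with (c := c)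
    (C0 := (stmt_cost inc_before + stmt_cost inc_after + 2) * 11
           + (stmt_cost load_problem + stmt_cost start_rounds + 2)).
  intros W n B L M g s hn hB hL hM hW hg hword hr hsim.
  assert (forall k, k <= 11 * (n * n) -> weights_le (stage n L M (completed g B) k) (3 * M))
    as hwt by (eapply stage_weights; eauto).
  set (os := map (insertion n B L M g) (seq 0 (11 * (n * n)))).
  destruct (hA (12 * n) 0 (9 * n) os (3 * M) W) as (t0 & st0 & t1 & e0 & e1 & ht);
    auto; try lia.
  - apply Forall_forall. intros o ho. apply in_map_iff in ho as (k & <- & _). exact Logic.I.
  - apply (insertions_legal W n B L M g hn hB hL hM hW (11 * (n * n)) 0). lia.
  - unfold os.
    change empty_graph with (stage n L M (completed g B) 0).
    rewrite (insertions_fold W n B L M g) by auto.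
    now apply hwt.
  - destruct (inc_driver_runs W n B L M g hn hB hL hM hW hg A st0 t0 t1 s hr hsim e0 e1)
      as (s' & t & x & hr' & hans & ht').
    exists s', t. repeat split; try assumption; try apply hr'; try apply hans; auto.
    nia.
Qed.

Lemma decremental_clique A T :
  solves_decremental_stSP A T ->
  exists C1, solves_min_clique 4 (clique_program (dec_driver A))
               (fun n => T (12 * n) + C1 * (n * n + 1)).
Proof.
  intros [c hA].
  eapply clique_program_solves with (c := c)
    (C0 := (stmt_cost store_edge + stmt_cost dec_before + stmt_cost dec_after + 4) * 11
           + (stmt_cost load_problem + 2 * stmt_cost start_rounds + 4)).
  intros W n B L M g s hn hB hL hM hW hg hword hr hsim.
  assert (forall k, k <= 11 * (n * n) -> weights_le (stage n L M (completed g B) k) (3 * M))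
    as hwt by (eapply stage_weights; eauto).
  set (K := 11 * (n * n)).
  destruct (hA (12 * n) 0 (9 * n) (stage n L M (completed g B) K) (deletions n K)
              (3 * M) W) as (t0 & st0 & t1 & e0 & e1 & ht); auto; try lia.
  - now apply stage_is_graph.
  - generalize K. intros k. induction k; cbn; constructor; auto. exact Logic.I.
  - now apply (deletions_legal W n B L M g).
  - intros u v. now rewrite (deletions_fold W n B L M g).
  - destruct (dec_driver_runs W n B L M g hn hB hL hM hW hg A st0 t0 t1 s hr hsim e0 e1)
      as (s' & t & x & hr' & hans & ht').
    exists s', t. repeat split; try assumption; try apply hr'; try apply hans; auto.
    unfold K in *. nia.
Qed.

(** The quadratic overhead has to be absorbed as well, which the exponent [4 - eps] cannot do for
    large [eps]; capping [eps] at 1 keeps the exponent at least 3. *)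
Lemma is_bigO_reduction T eps C1 :
  (0 < eps)%R -> is_bigO T (fun n => Rpower (INR n) (4 - eps)) ->
  is_bigO (fun n => T (12 * n) + C1 * (n * n + 1))
          (fun n => Rpower (INR n) (INR 4 - Rmin eps 1)).
Proof.
  intros heps (K & n0 & H). replace (INR 4) with 4%R by (simpl; ring).
  set (e := (4 - Rmin eps 1)%R).
  assert (4 - eps <= e)%R as he1 by (unfold e; pose proof (Rmin_l eps 1); lra).
  assert (INR 2 <= e)%R as he2 by (unfold e; pose proof (Rmin_r eps 1); simpl; lra).
  (* [K] may be negative, hence [Rabs K]. For [n >= 1] powers are monotone in the exponent and
     [n * n + 1] is at most twice [n * n]. *)
  exists (Rabs K * Rpower 12 e + 2 * INR C1)%R, (max n0 1). intros n hn.
  assert (1 <= INR n)%R as h1 by (apply (le_INR 1); lia).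
  rewrite plus_INR, Rmult_plus_distr_r. apply Rplus_le_compat.
  - eapply Rle_trans; [apply H; lia|]. rewrite mult_INR.
    replace (INR 12) with 12%R by (simpl; ring).
    rewrite Rmult_assoc, Rpower_mult_distr by lra.
    apply Rle_trans with (Rabs K * Rpower (12 * INR n) (4 - eps))%R.
    + apply Rmult_le_compat_r; [left; apply exp_pos|apply Rle_abs].
    + apply Rmult_le_compat_l; [apply Rabs_pos|].
      apply Rle_Rpower; [lra|exact he1].
  - assert (INR n * INR n <= Rpower (INR n) e)%R as h2.
    { replace (INR n * INR n)%R with (INR n ^ 2)%R by ring.
      rewrite <- Rpower_pow by lra. now apply Rle_Rpower. }
    rewrite mult_INR, plus_INR, mult_INR. pose proof (pos_INR C1). simpl (INR 1).
    rewrite (Rmult_comm 2), Rmult_assoc. apply Rmult_le_compat_l; [auto|nra].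
Qed.

Theorem theorem1p1 :
  min_weight_clique_hypothesis 4 ->
  (forall (A : dyn_alg) (T : nat -> nat),
     solves_incremental_stSP A T ->
     forall eps : R, (0 < eps)%R ->
       ~ is_bigO T (fun n => Rpower (INR n) (4 - eps)))
  /\
  (forall (A : dyn_alg) (T : nat -> nat),
     solves_decremental_stSP A T ->
     forall eps : R, (0 < eps)%R ->
       ~ is_bigO T (fun n => Rpower (INR n) (4 - eps))).
Proof.
  intros hyp.
  assert (forall eps, (0 < eps)%R -> (0 < Rmin eps 1)%R) as hmin
    by (intros; apply Rmin_glb_lt; lra).
  split; intros A T hA eps heps hT;
    [destruct (incremental_clique A T hA) as [C1 hC]
    |destruct (decremental_clique A T hA) as [C1 hC]];
    (eapply (hyp (Rmin eps 1)); [now apply hmin|]);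
    eexists _, _; (split; [exact hC|now apply is_bigO_reduction]).
Qed.
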